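(* Let $n\geq 51$ and let $G$ be a 2-connected claw-free graph on $n$ vertices. If $q(G)\geq q(EP_n)$, then $G$ is Hamiltonian unless $G\cong EP_n$.
   Context: All graphs are finite and simple. A graph is claw-free if it has no induced subgraph isomorphic to $K_{1,3}$. For a graph $H$ with adjacency matrix $A$ and diagonal degree matrix $D$, $q(H)$ denotes the largest eigenvalue of the signless Laplacian $D+A$. For $n\geq 9$, $EP_n$ is the graph on $n$ vertices defined as follows: take a clique $Q$ on $n-6$ vertices with three distinct distinguished vertices $a_1,a_2,a_3\in Q$, and six further vertices $b_1,b_2,b_3,c_1,c_2,c_3$; the edges are all pairs inside $Q$, the edges $b_1b_2,b_2b_3,b_1b_3$, and for each $i\in\{1,2,3\}$ the edges $a_ib_i$, $a_ic_i$, $b_ic_i$ (and no others). *)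

(* Defs.v *)
From HB Require Import structures.
From mathcomp Require Import all_boot all_order all_algebra.
From mathcomp Require Import complex.
From mathcomp Require Import classical_sets reals.
Set Implicit Arguments.
Unset Strict Implicit.
Unset Printing Implicit Defensive.
Import Order.TTheory GRing.Theory Num.Theory.
Local Open Scope ring_scope.

Record sgraph := SGraph {
  vertex :> finType;
  adj : rel vertex;
  adj_sym : symmetric adj;
  adj_irrefl : irreflexive adj
}.

Definition isomorphic (G H : sgraph) : Prop :=
  exists2 f : G -> H, bijective f & forall x y, adj (f x) (f y) = adj x y.

Section Induced.
Variables (G : sgraph) (S : {set G}).
Definition induced_adj : rel {x : G | x \in S} :=
  fun x y => adj (val x) (val y).
Lemma induced_adj_sym : symmetric induced_adj.
Proof. by move=> x y; apply: adj_sym. Qed.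
Lemma induced_adj_irrefl : irreflexive induced_adj.
Proof. by move=> x; apply: adj_irrefl. Qed.
Definition induced : sgraph := SGraph induced_adj_sym induced_adj_irrefl.
End Induced.

Section CompleteBipartite.
Variables m n : nat.
Definition Kmn_adj : rel ('I_m + 'I_n)%type := fun x y =>
  match x, y with
  | inl _, inr _ | inr _, inl _ => true
  | _, _ => false
  end.
Lemma Kmn_adj_sym : symmetric Kmn_adj.
Proof. by move=> [i|i] [j|j]. Qed.
Lemma Kmn_adj_irrefl : irreflexive Kmn_adj.
Proof. by move=> [i|i]. Qed.
Definition Kmn : sgraph := SGraph Kmn_adj_sym Kmn_adj_irrefl.
End CompleteBipartite.

Definition claw_free (G : sgraph) : Prop :=
  forall S : {set G}, ~ isomorphic (induced S) (Kmn 1 3).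

Definition connected (G : sgraph) : Prop :=
  forall x y : G, connect (@adj G) x y.

Definition k_connected (k : nat) (G : sgraph) : Prop :=
  (k < #|G|)%N /\
  forall S : {set G}, (#|S| < k)%N -> connected (induced (~: S)).

(* The size bound matters: [ucycle] also accepts the empty sequence and a
   single edge traversed back and forth. *)
Definition hamiltonian (G : sgraph) : Prop :=
  exists c : seq G,
    [/\ (2 < size c)%N, ucycle (@adj G) c & forall x, x \in c].

Section SignlessLaplacian.
Variables (R : realType) (G : sgraph).

Definition degree (x : G) : nat := #|[set y | adj x y]|.

Definition adjacency : 'M[R]_#|G| :=
  \matrix_(i, j) (adj (enum_val i) (enum_val j))%:R.

Definition degree_mx : 'M[R]_#|G| := diag_mx (\row_i (degree (enum_val i))%:R).

Definition signless_laplacian : 'M[R]_#|G| := degree_mx + adjacency.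

(* By [q_largest] below, for a nonempty graph this supremum is a maximum. *)
Definition q : R := sup [set x | eigenvalue signless_laplacian x]%classic.

End SignlessLaplacian.

Lemma symmetric_eigenvalues (R : rcfType) (n : nat) (A : 'M[R]_n) :
  A^T = A -> exists2 s : seq R, size s = n & forall x, eigenvalue A x = (x \in s).
Proof.
move=> symA; pose toC := real_complex R.
pose B := map_mx toC A.
have [rs Ers] := closed_field_poly_normal (char_poly B).
have monB : lead_coef (char_poly B) = 1 by apply/monicP/char_poly_monic.
rewrite monB scale1r in Ers.
have sz : size rs = n.
  have := size_char_poly B.
  by rewrite Ers size_prod_XsubC => -[].
have realrs z : z \in rs -> toC (complex.Re z) = z.
  move=> zrs; have : eigenvalue B z.
    by rewrite eigenvalue_root_char Ers root_prod_XsubC.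
  case/eigenvalueP => v vB v0.
  pose w := (map_mx (@conjc R) v)^T.
  have conjB : map_mx (@conjc R) B = B.
    apply/matrixP => i j; rewrite !mxE /toC /=.
    by congr (_ +i* _)%C; rewrite oppr0.
  have BT : B^T = B by rewrite /B map_trmx symA.
  have Bw : B *m w = conjc z *: w.
    rewrite /w -[in LHS]BT -trmx_mul -[in LHS]conjB -map_mxM vB map_mxZ.
    by rewrite linearZ.
  have /eqP : (z - conjc z) *: (v *m w) = 0.
    rewrite scalerBl scalemxAl -vB -mulmxA Bw -scalemxAr.
    by rewrite subrr.
  rewrite scaler_eq0 => /orP[|/eqP vw].
    rewrite subr_eq0 => /eqP; case: z {zrs vB Bw} => a b [] /= /eqP.
    by rewrite -addr_eq0 -mulr2n mulrn_eq0 /= => /eqP ->.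
  case/eqP: v0; apply/rowP => i; rewrite mxE.
  have /matrixP/(_ 0 0) := vw; rewrite !mxE => sum0.
  have : `|v 0 i| ^+ 2 = 0.
    have pos : forall k : 'I_n, true -> 0 <= `|v 0 k| ^+ 2.
      by move=> k _; rewrite exprn_ge0.
    apply: (psumr_eq0P pos) => //; rewrite -[RHS]sum0.
    by apply: eq_bigr => k _; rewrite !mxE normCK.
  by move/eqP; rewrite sqrf_eq0 normr_eq0 => /eqP.
exists (map (@complex.Re R) rs); first by rewrite size_map.
move=> x; rewrite -(eigenvalue_map toC) eigenvalue_root_char -/B Ers root_prod_XsubC.
apply/idP/mapP => [xrs|[z zrs ->]]; first by exists (toC x).
by move: (realrs z zrs) => /= /(congr1 (fun t => t \in rs)) /= ->.
Qed.

Lemma signless_laplacian_sym (R : realType) (G : sgraph) :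
  (signless_laplacian R G)^T = signless_laplacian R G.
Proof.
apply/matrixP => i j; rewrite !mxE adj_sym eq_sym.
by case: eqP => [->|].
Qed.

Lemma q_largest (R : realType) (G : sgraph) : (0 < #|G|)%N ->
  eigenvalue (signless_laplacian R G) (q R G) /\
  forall x, eigenvalue (signless_laplacian R G) x -> x <= q R G.
Proof.
move=> G0; have [s] := symmetric_eigenvalues (signless_laplacian_sym R G).
case: s => [sz|x0 s _ Es]; first by rewrite -sz in G0.
have [m ms mmax] : exists2 m, m \in x0 :: s & forall x, x \in x0 :: s -> x <= m.
  elim: s x0 {Es} => [|y s IH] x0.
    by exists x0 => [|x]; rewrite inE ?eqxx // => /eqP ->.
  have [m ms mmax] := IH y; case: (leP x0 m) => xm.
    exists m => [|x]; rewrite inE ?ms ?orbT // => /predU1P[->//|].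
    exact: mmax.
  exists x0 => [|x]; rewrite inE ?eqxx // => /predU1P[->//|/mmax].
  by move/le_trans; apply; apply: ltW.
have qm : q R G = m.
  apply/eqP; rewrite eq_le; apply/andP; split.
    by apply: ge_sup => [|x /=]; [exists m; rewrite /= Es|rewrite Es; apply: mmax].
  apply: ub_le_sup; last by rewrite /= Es.
  by exists m => x /=; rewrite Es; apply: mmax.
by rewrite qm; split=> [|x]; rewrite Es //; apply: mmax.
Qed.

(* The vertices are the clique Q = 'I_(n - 6), then b_1, b_2, b_3 and
   c_1, c_2, c_3, each indexed by 'I_3 (from 0); a_i is the element of Q with
   value i. Meaningful for 9 <= n, where the three a_i exist and the order
   is n. *)
Section EP.
Variable n : nat.

Inductive EP_class := EPq of 'I_(n - 6) | EPb of 'I_3 | EPc of 'I_3.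

Definition EP_encode (x : EP_class) : 'I_(n - 6) + ('I_3 + 'I_3) :=
  match x with EPq u => inl u | EPb i => inr (inl i) | EPc i => inr (inr i) end.
Definition EP_decode (x : 'I_(n - 6) + ('I_3 + 'I_3)) : EP_class :=
  match x with inl u => EPq u | inr (inl i) => EPb i | inr (inr i) => EPc i end.
Lemma EP_encodeK : cancel EP_encode EP_decode. Proof. by case. Qed.
Lemma EP_decodeK : cancel EP_decode EP_encode. Proof. by case=> [|[]]. Qed.
HB.instance Definition _ := Finite.copy EP_class (can_type EP_encodeK).

Definition EP_adj : rel EP_class := fun x y =>
  match x, y with
  | EPq u, EPq v => u != v
  | EPb i, EPb j => i != j
  | EPc _, EPc _ => false
  | EPq u, EPb i | EPb i, EPq u | EPq u, EPc i | EPc i, EPq u => u == i :> nat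
  | EPb i, EPc j | EPc j, EPb i => i == j
  end.
Lemma EP_adj_sym : symmetric EP_adj.
Proof. by case=> i [] j //=; rewrite eq_sym. Qed.
Lemma EP_adj_irrefl : irreflexive EP_adj.
Proof. by case=> i //=; rewrite eqxx. Qed.
Definition EP : sgraph := SGraph EP_adj_sym EP_adj_irrefl.

Lemma card_EP : (9 <= n)%N -> #|EP| = n.
Proof.
move=> n9; rewrite (bij_eq_card (Bijective EP_encodeK EP_decodeK)).
by rewrite !card_sum !card_ord subnK // (leq_trans _ n9).
Qed.
End EP.

(* Main.v *)
Require Import Defs.
From mathcomp Require Import all_boot all_order all_algebra.
From mathcomp Require Import reals.
From mathcomp Require Import boolp complex spectral sesquilinear.
From mathcomp Require Import ring lra zify.
Set Implicit Arguments.
Unset Strict Implicit.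
Unset Printing Implicit Defensive.
Import Order.TTheory GRing.Theory Num.Theory.

(* Completing the neighbourhood of a vertex x whose neighbours induce a connected
   non-complete graph keeps a claw-free graph claw-free, does not decrease q,
   and does not create a Hamiltonian cycle (Ryjacek); so one may assume that G
   is claw-free and diamond-free, where every neighbourhood is a disjoint union
   of two cliques without edges between them. As q(G) >= q(EP_n) > 2n - 14,
   testing q with the degree vector gives a vertex v with
   d(v)^2 + sum_{u ~ v} d(u) > (2n - 14) d(v), and the larger of the two cliques
   around v yields a clique K with at most six vertices outside it, each having
   at most one neighbour in K. If there are exactly six and one of them has no
   neighbour in K, then at most five edges leave K, and a test vector gives
   q(G) < 2n - 14 + 6/(n - 6) <= q(EP_n).
   Otherwise, take a system of disjoint ears (paths with interior outside K and
   distinct ends in K) covering as many vertices as possible. If it covers all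
   vertices outside K, then G is Hamiltonian. If it misses one, then
   2-connectedness gives a detour between two places of the system, and
   maximality forces the six outer vertices to form the net of EP_n, so G is a
   spanning subgraph of EP_n, and q(G) >= q(EP_n) forces equality. *)

(** * Local completion *)

(** The number 2n - 14 is q of a clique on n - 6 vertices, and 6/(n - 6) is what the six edges
    leaving the clique of EP_n add to the Rayleigh quotient of its indicator. The degree vector
    serves only to bound the outer part by six vertices; telling five leaving edges from six takes a
    vector that depends on where these edges start. Since ends of ears are pairwise adjacent in [K],
    ears can be linked in any order, and Hamiltonicity becomes a covering problem on at most six
    vertices. Two consequences of claw-freeness drive the exchanges: an ear vertex with an uncovered
    neighbour can be lifted out of its place, because its two neighbours on the ear are adjacent;
    and the outer neighbours of a clique vertex are pairwise adjacent. Completion may well turn G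
    into EP_n. This does no harm: q grows strictly when an edge is added to a connected graph, by
    positivity of an eigenfunction, so q(G) >= q(EP_n) shows that nothing was added. *)

Definition claw_free_rel (T : finType) (e : rel T) : Prop :=
  forall c u v w, e c u -> e c v -> e c w -> u != v -> u != w -> v != w ->
  [|| e u v, e u w | e v w].

Definition hamiltonian_rel (T : finType) (e : rel T) : Prop :=
  exists c : seq T, [/\ (2 < size c)%N, ucycle e c & forall x, x \in c].

Definition local_completion (T : eqType) (e : rel T) (x : T) : rel T :=
  fun u v => e u v || [&& u != v, e x u & e x v].

Lemma sorted_cat (T : eqType) (e : rel T) x s t : s != [::] -> t != [::] ->
  sorted e (s ++ t) = [&& sorted e s, sorted e t & e (last x s) (head x t)].
Proof.
case: s t => [//|a s] [//|b t] _ _ /=; rewrite cat_path /=.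
by case: path => //=; rewrite andbC.
Qed.

Lemma sorted_rev_sym (T : eqType) (e : rel T) s :
  symmetric e -> sorted e (rev s) = sorted e s.
Proof.
by move=> se; rewrite rev_sorted; apply: eq_sorted => a b; rewrite se.
Qed.

Lemma head_cat_neq (T : eqType) (x : T) s t : s != [::] -> head x (s ++ t) = head x s.
Proof. by case: s. Qed.

Lemma last_revE (T : Type) (x : T) s : last x (rev s) = head x s.
Proof. by case: s => // a s; rewrite rev_cons last_rcons. Qed.

Lemma head_revE (T : Type) (x : T) s : head x (rev s) = last x s.
Proof. by rewrite -[in RHS](revK s) last_revE. Qed.

Lemma not_sorted (T : eqType) (e : rel T) x s : ~~ sorted e s ->
  exists A B, [/\ s = A ++ B, A != [::], B != [::] & ~~ e (last x A) (head x B)].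
Proof.
elim: s => // a [//|b s] IH /=; rewrite negb_and; case: (boolP (e a b)) => ab /=.
  move/IH => [A [B [-> A0 B0 nAB]]]; exists (a :: A), B; split => //.
  by case: A A0 nAB {IH} => // c A.
by move=> _; exists [:: a], (b :: s).
Qed.

Section LocalCompletion.
Variables (T : finType) (e : rel T).
Hypotheses (sym_e : symmetric e) (irr_e : irreflexive e).
Hypothesis claw_e : claw_free_rel e.

Lemma local_completion_sym x : symmetric (local_completion e x).
Proof.
by move=> u v; rewrite /local_completion sym_e eq_sym [e x u && _]andbC.
Qed.

Lemma local_completion_irrefl x : irreflexive (local_completion e x).
Proof. by move=> u; rewrite /local_completion irr_e eqxx. Qed.

(** If the edge from the centre [c] to some leaf is new, both its ends lie in N(x). The other two
    leaves, not adjacent to that leaf, then lie outside N[x] and are joined to [c] by old edges, so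
    that [x] in place of that leaf gives a claw of [e]. *)
Lemma local_completion_claw_free x : claw_free_rel (local_completion e x).
Proof.
move=> c u v w cu cv cw uv uw vw; set e' := local_completion e x in cu cv cw *.
apply: contraT => /norP[nuv /norP[nuw nvw]].
have old y z : e x c -> e x y -> y != z -> e' c z -> ~~ e' y z ->
    [/\ e c z, ~~ e x z & z != x].
  rewrite /e' /local_completion => xc xy yz; rewrite xc xy yz /=.
  rewrite negb_or => cz /andP[nyz nxz]; rewrite (negPf nxz) andbF orbF in cz.
  by split=> //; apply: contraNneq nyz => ->; rewrite sym_e xy.
have noclaw y z : e x c -> ~~ e x y -> ~~ e x z -> y != x -> z != x ->
    e c y -> e c z -> y != z -> ~~ e' y z -> False.
  move=> xc xy xz yx zx cy cz yz; have := claw_e (c := c) (u := x) (v := y) (w := z).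
  rewrite sym_e xc cy cz (negPf xy) (negPf xz) yz ![x == _]eq_sym yx zx /=.
  by move=> /(_ isT isT isT isT isT isT) yez; rewrite /e' /local_completion yez.
have [ecu|] := boolP (e c u); last first.
  move: (cu); rewrite {1}/e' /local_completion => /orP[-> //|/and3P[_ xc xu] _].
  have [cv' xv vx] := old u v xc xu uv cv nuv.
  have [cw' xw wx] := old u w xc xu uw cw nuw.
  by case: (noclaw v w).
have [ecv|] := boolP (e c v); last first.
  move: (cv); rewrite {1}/e' /local_completion => /orP[-> //|/and3P[_ xc xv] _].
  have nvu : ~~ e' v u by rewrite /e' local_completion_sym.
  have [cu' xu ux] := old v u xc xv ltac:(by rewrite eq_sym) cu nvu.
  have [cw' xw wx] := old v w xc xv vw cw nvw.
  by case: (noclaw u w).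
have [ecw|] := boolP (e c w); last first.
  move: (cw); rewrite {1}/e' /local_completion => /orP[-> //|/and3P[_ xc xw] _].
  have nwu : ~~ e' w u by rewrite /e' local_completion_sym.
  have nwv : ~~ e' w v by rewrite /e' local_completion_sym.
  have [cu' xu ux] := old w u xc xw ltac:(by rewrite eq_sym) cu nwu.
  have [cv' xv vx] := old w v xc xw ltac:(by rewrite eq_sym) cv nwv.
  by case: (noclaw u v).
have /or3P := claw_e ecu ecv ecw uv uw vw.
by case=> h; [case/negP: nuv|case/negP: nuw|case/negP: nvw];
  rewrite /e' /local_completion h.
Qed.

(** * Pulling a Hamiltonian cycle back from the completion *)

Section Hamiltonicity.
Variable x : T.
Local Notation N := (e x).

(** With [p] as default value, a neighbour of [x] at an end of [P] meets the condition for free. The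
    condition allows a piece with adjacent ends to be reopened at [p] so that the other new end is
    still in N(x). *)
Definition neighbor_beside (P : seq T) : Prop := forall p, p \in P -> N p ->
  exists A B, P = A ++ p :: B /\ (N (last p A) \/ N (head p B)).

(* As [N x] is false, the default value of [head] and [last] rules out the
   empty sequence. *)
Definition piece (P : seq T) : Prop :=
  [/\ sorted e P, N (head x P), N (last x P) & neighbor_beside P].

Lemma piece_nil P : piece P -> P != [::].
Proof. by case: P => // -[_ /=]; rewrite irr_e. Qed.

Lemma last_neq_nil (y z : T) s : s != [::] -> last y s = last z s.
Proof. by case: s. Qed.

Lemma head_neq_nil (y z : T) (s : seq T) : s != [::] -> head y s = head z s.
Proof. by case: s. Qed.

Lemma piece_rev P : piece P -> piece (rev P).
Proof.
case=> sP hP lP nP; split; rewrite ?sorted_rev_sym ?last_revE ?head_revE // => p.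
rewrite mem_rev => /nP/[apply] -[A [B [-> AB]]]; exists (rev B), (rev A).
rewrite last_revE head_revE rev_cat rev_cons cat_rcons; split => //.
by case: AB; [right|left].
Qed.

Lemma piece_cat P Q : piece P -> piece Q -> e (last x P) (head x Q) -> piece (P ++ Q).
Proof.
move=> pP pQ PQ; have P0 := piece_nil pP; have Q0 := piece_nil pQ.
case: (pP) => sP hP lP nP; case: (pQ) => sQ hQ lQ nQ; split.
- by rewrite (sorted_cat _ x) // sP sQ.
- by rewrite head_cat_neq.
- by rewrite last_cat (last_neq_nil _ x).
move=> p; rewrite mem_cat; case: (boolP (p \in P)) => [pinP _ Np|_ /= pinQ Np].
  have [A [B [defP AB]]] := nP p pinP Np; exists A, (B ++ Q).
  split; first by rewrite defP -catA.
  case: AB => [|HB]; [by left|right].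
  by case: B HB {defP} => //= _; rewrite (head_neq_nil _ x).
have [A [B [defQ AB]]] := nQ p pinQ Np; exists (P ++ A), B.
split; first by rewrite defQ catA.
case: AB => [HA|]; [left|by right].
by rewrite last_cat; case: A HA {defQ} => //= _; rewrite (last_neq_nil _ x).
Qed.

(** The path is cut at new edges, whose ends lie in N(x). A vertex [p] of N(x) without a path
    neighbour in N(x) becomes a piece of its own: its two path neighbours are adjacent, since
    otherwise they form a claw with [x] at [p], so the rest closes up. *)
Lemma pieces_of s : uniq s -> x \notin s -> N (head x s) -> N (last x s) ->
  sorted (fun u v => e u v || (N u && N v)) s ->
  exists L, (forall P, P \in L -> piece P) /\ perm_eq (flatten L) s.
Proof.
have [m] := ubnP (size s); elim: m s => // m IH s /ltnSE sm us xs hs ls ss.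
have [gs|] := pselect (neighbor_beside s).
  have [es|/(not_sorted x)[A [B [defs A0 B0 nAB]]]] := boolP (sorted e s).
    exists [:: s]; rewrite /= cats0; split => // P.
    by rewrite inE => /eqP ->.
  move: ss; rewrite defs (sorted_cat _ x) // (negPf nAB) /= => /and3P[sA sB /andP[lA hB]].
  move: hs ls us xs sm; rewrite defs last_cat (last_neq_nil _ x) //.
  rewrite cat_uniq size_cat mem_cat => hs ls /and3P[uA _ uB] /norP[xA xB] sm.
  rewrite head_cat_neq // in hs.
  have a0 : (0 < size A)%N by rewrite lt0n size_eq0.
  have b0 : (0 < size B)%N by rewrite lt0n size_eq0.
  have [||||||LA [pA permA]] := IH A; [by apply: leq_trans sm; rewrite -addn1 leq_add2l|by []..|].
  have [||||||LB [pB permB]] := IH B; [by apply: leq_trans sm; rewrite -add1n leq_add2r|by []..|].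
  exists (LA ++ LB); split; last by rewrite flatten_cat perm_cat.
  by move=> P; rewrite mem_cat => /orP[/pA|/pB].
move=> /existsNP[p] /not_implyP[ps] /not_implyP[Np nAB].
have [A [B defs]] : exists A B, s = A ++ p :: B.
  by case/splitPr: ps => A B; exists A, B.
have [nA nB] : ~~ N (last p A) /\ ~~ N (head p B).
  by split; apply/negP => H; apply: nAB; exists A, B; split => //; [left|right].
have A0 : A != [::] by apply: contraNneq nA => ->.
have B0 : B != [::] by apply: contraNneq nB => ->.
have B1 : p :: B != [::] by [].
rewrite (last_neq_nil _ x) // in nA; rewrite (head_neq_nil _ x) // in nB.
move: ss; rewrite defs (sorted_cat _ x) // -cat1s (sorted_cat _ x) //=.
rewrite (negPf nA) (negPf nB) !andbF !orbF => /and3P[sA /andP[sB pB] Ap].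
have AB : e (last x A) (head x B).
  have wA : last x A \in A by case: A A0 {defs nA sA Ap} => //= a A _; rewrite mem_last.
  have wB : head x B \in B.
    by case: B B0 {defs nB B1 sB pB} => //= b B _; rewrite inE eqxx.
  have xneq z : z \in A ++ B -> x != z.
    by move=> zAB; apply: contraNneq xs => ->; rewrite defs mem_cat inE orbCA -mem_cat zAB orbT.
  have wneq : last x A != head x B.
    move: us; rewrite defs cat_uniq => /and3P[_ /hasPn/(_ (head x B)) + _].
    by rewrite inE wB orbT => /(_ isT); apply: contraNneq => <-.
  have pw : e p (last x A) by rewrite sym_e.
  have px : e p x by rewrite sym_e.
  have := claw_e px pw pB; rewrite (negPf nA) (negPf nB) /=.
  by apply=> //; apply: xneq; rewrite mem_cat ?wA ?wB ?orbT.
have pAB : perm_eq s (p :: A ++ B) by rewrite defs -[p :: B]cat1s perm_catCA.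
have [||||||L [pL permL]] := IH (A ++ B).
- by move/perm_size: pAB sm => -> /=.
- by move: us; rewrite (perm_uniq pAB) => /andP[].
- by move: xs; rewrite (perm_mem pAB) inE => /norP[].
- by move: hs; rewrite defs !head_cat_neq.
- by move: ls; rewrite defs !last_cat /= !(last_neq_nil _ x B0).
- by rewrite (sorted_cat _ x) // sA sB AB.
exists ([:: [:: p]] ++ L); split; last by rewrite -defs (permPr pAB) /= perm_cons.
move=> P; rewrite /= inE => /predU1P[->|]; last exact: pL.
split=> //= q; rewrite inE => /eqP -> _; exists [::], [::]; split => //.
by left.
Qed.

(** If [last p A] is in N(x), the rotation [p :: B ++ A] passes through the closing edge and ends in
    N(x); the case of [head p B] is its mirror image. Equal ends mean a single vertex, by
    uniqueness. *)
Lemma piece_rotate P p : piece P -> p \in P -> N p ->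
  head x P = last x P \/ e (last x P) (head x P) ->
  uniq P -> exists P', [/\ perm_eq P' P, head x P' = p, sorted e P' & N (last x P')].
Proof.
move=> pP pinP Np closed uP; case: (pP) => sP hP lP nP.
suff key Q : perm_eq Q P -> sorted e Q -> N (head x Q) -> N (last x Q) ->
    (head x Q = last x Q \/ e (last x Q) (head x Q)) ->
    (exists A B, Q = A ++ p :: B /\ N (last p A)) ->
    exists P', [/\ perm_eq P' P, head x P' = p, sorted e P' & N (last x P')].
  have [A [B [defP [HA|HB]]]] := nP p pinP Np.
    by apply: (key P) => //; exists A, B.
  apply: (key (rev P)); rewrite ?sorted_rev_sym ?last_revE ?head_revE //.
  - by rewrite perm_rev.
  - by case: closed => [->|]; [left|right; rewrite sym_e].
  exists (rev B), (rev A).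
  by rewrite last_revE defP rev_cat rev_cons cat_rcons.
move=> permQ sQ hQ lQ cQ [A [B [defQ HA]]].
have [A0|A0] := eqVneq A [::].
  by exists Q; split=> //; rewrite defQ A0.
have pB0 : p :: B != [::] by [].
exists (p :: B ++ A); split=> //.
- by rewrite -(permPr permQ) defQ -cat_cons perm_catC.
- move: sQ; rewrite -cat_cons defQ !(sorted_cat _ x) // => /and3P[-> -> _] /=.
  rewrite defQ head_cat_neq // last_cat /= in cQ.
  case: cQ => // hl; move: uP; rewrite -(perm_uniq permQ) defQ cat_uniq.
  case/and3P => _ /hasPn/(_ (last p B)); rewrite mem_last => /(_ isT).
  by rewrite -hl; case: A A0 {defQ HA hl} => //= a A _; rewrite inE eqxx.
by rewrite /= last_cat; case: A A0 HA {defQ} => //= a A _; rewrite (last_neq_nil _ x).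
Qed.

Lemma nbr_indep3 u v w : N u -> N v -> N w -> u != v -> u != w -> v != w ->
  [|| e u v, e u w | e v w].
Proof. exact: claw_e. Qed.

Lemma piece_head_in P : piece P -> head x P \in P.
Proof. by case: P => [[]|a P _]; rewrite /= ?irr_e // inE eqxx. Qed.

Lemma piece_last_in P : piece P -> last x P \in P.
Proof. by case: P => [[]|a P _]; rewrite /= ?irr_e // mem_last. Qed.

Lemma piece_join P Q u v : piece P -> piece Q ->
  u \in [:: head x P; last x P] -> v \in [:: head x Q; last x Q] -> e u v ->
  exists2 W, piece W & perm_eq W (P ++ Q).
Proof.
move=> pP pQ uP vQ uv.
have [P' [pP' permP lP]] : exists P', [/\ piece P', perm_eq P' P & last x P' = u].
  move: uP; rewrite !inE => /orP[]/eqP ->; last by exists P.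
  by exists (rev P); rewrite perm_rev last_revE; split=> //; apply: piece_rev.
have [Q' [pQ' permQ hQ]] : exists Q', [/\ piece Q', perm_eq Q' Q & head x Q' = v].
  move: vQ; rewrite !inE => /orP[]/eqP ->; first by exists Q.
  by exists (rev Q); rewrite perm_rev head_revE; split=> //; apply: piece_rev.
exists (P' ++ Q'); first by apply: piece_cat; rewrite // lP hQ.
exact: perm_cat.
Qed.

Lemma merge_pieces L : (forall P, P \in L -> piece P) -> uniq (flatten L) ->
  (0 < size L)%N ->
  exists M, [/\ (forall P, P \in M -> piece P), perm_eq (flatten M) (flatten L),
    (0 < size M)%N & (size M <= 2)%N].
Proof.
have [m] := ubnP (size L); elim: m L => // m IH.
case=> [//|P [|Q L]] sL pL uL _; [by exists [:: P]|].
case: L sL pL uL => [|W L] sL pL uL; first by exists [:: P; Q].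
have [pP pQ pW] : [/\ piece P, piece Q & piece W].
  by split; apply: pL; rewrite !inE eqxx ?orbT.
have pL' Z : Z \in L -> piece Z by move=> ZL; apply: pL; rewrite !inE ZL !orbT.
have reduce A B C : piece C -> (exists2 Z, piece Z & perm_eq Z (A ++ B)) ->
    perm_eq (A ++ B ++ C) (P ++ Q ++ W) ->
  exists M, [/\ (forall P, P \in M -> piece P),
    perm_eq (flatten M) (flatten [:: P, Q, W & L]),
    (0 < size M)%N & (size M <= 2)%N].
  move=> pC [Z pZ permZ] permABC.
  have permZC : perm_eq (flatten [:: Z, C & L]) (flatten [:: P, Q, W & L]).
    rewrite /= !catA perm_cat2r -!catA -(permPr permABC) catA perm_cat2r //.
  have [||||M [pM permM M0 M2]] := IH [:: Z, C & L] => //.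
  - by move=> X; rewrite !inE => /or3P[/eqP ->|/eqP ->|/pL'].
  - by rewrite (perm_uniq permZC).
  - by exists M; split => //; apply: perm_trans permZC.
move: uL; rewrite /= !cat_uniq => /and3P[_ /hasPn PQW].
move=> /and3P[_ /hasPn QW _].
have hP := piece_head_in pP; have hQ := piece_head_in pQ; have hW := piece_head_in pW.
have dPQ : head x P != head x Q.
  by apply: contraTneq hP => ->; apply: PQW; rewrite mem_cat hQ.
have dPW : head x P != head x W.
  by apply: contraTneq hP => ->; apply: PQW; rewrite !mem_cat hW orbT.
have dQW : head x Q != head x W.
  by apply: contraTneq hQ => ->; apply: QW; rewrite mem_cat hW.
have hd Z : head x Z \in [:: head x Z; last x Z] by rewrite inE eqxx.
case: (pP) (pQ) (pW) => _ NP _ _ [_ NQ _ _] [_ NW _ _].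
have /or3P[h|h|h] := nbr_indep3 NP NQ NW dPQ dPW dQW.
- by apply: (reduce P Q W) => //; apply: piece_join h.
- apply: (reduce P W Q) => //; first exact: piece_join h.
  by rewrite perm_cat2l perm_catC.
- apply: (reduce Q W P) => //; first exact: piece_join h.
  by rewrite catA perm_catC.
Qed.


Lemma close_hamiltonian c W : (2 < size c)%N -> uniq c -> (forall y, y \in c) ->
  perm_eq (x :: W) c -> sorted e W -> N (head x W) -> N (last x W) ->
  hamiltonian_rel e.
Proof.
move=> c2 uc allc permW sW hW lW; exists (x :: W); split.
- by rewrite (perm_size permW).
- rewrite /ucycle (perm_uniq permW) uc andbT /=.
  case: W sW hW lW {permW} => [|a W] /=; first by rewrite irr_e.
  by rewrite rcons_path => -> -> ; rewrite sym_e.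
- by move=> y; rewrite (perm_mem permW).
Qed.

(* Without its edges inside N[x], a Hamiltonian cycle of the completion is a
   family of paths with ends in N(x). As N(x) has no three independent vertices,
   they merge into at most two; if no ends of two paths are adjacent, both paths
   close up, and may be opened at the ends of an edge of N(x) between them. *)
Lemma local_completion_hamiltonian :
  (forall (A : pred T) y z, N y -> A y -> N z -> ~~ A z ->
    exists p q, [/\ N p, N q, A p, ~~ A q & e p q]) ->
  hamiltonian_rel (local_completion e x) -> hamiltonian_rel e.
Proof.
move=> conN [c [c2 /andP[cycc uc] allc]].
have [i s defc] := rot_to (allc x).
have permc : perm_eq (x :: s) c by rewrite -defc perm_rot.
have xs_uniq : uniq (x :: s) by rewrite (perm_uniq permc).
have /andP[xs us] := xs_uniq.
have Nx y : local_completion e x x y = N y.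
  by rewrite /local_completion irr_e andbF orbF.
have [L [pL permL]] : exists L, (forall P, P \in L -> piece P) /\ perm_eq (flatten L) s.
  have : cycle (local_completion e x) (x :: s) by rewrite -defc rot_cycle.
  move: (perm_size permc) c2; case: s us xs {defc permc xs_uniq} => [_ _ /= <- //|a s us xs _ _].
  rewrite /= Nx rcons_path local_completion_sym Nx => /and3P[xa sa la].
  apply: pieces_of => //=; apply: sub_path sa => u v.
  by rewrite /local_completion => /orP[-> //|/and3P[_ -> ->]]; rewrite orbT.
have uL : uniq (flatten L) by rewrite (perm_uniq permL).
have L0 : (0 < size L)%N.
  case: L permL {pL uL} => //=; rewrite perm_sym => /perm_size /= s0.
  by move: (perm_size permc) c2 => /= <-; rewrite s0.
have [M [pM permM M0 M2]] := merge_pieces pL uL L0.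
have permMc : perm_eq (x :: flatten M) c.
  apply: perm_trans permc; rewrite perm_cons; exact: perm_trans permL.
have one W : piece W -> perm_eq W (flatten M) -> hamiltonian_rel e.
  case=> sW hW lW _ permW; apply: close_hamiltonian (sW) (hW) (lW) => //; try eassumption.
  by apply: perm_trans permMc; rewrite perm_cons.
case: M M0 M2 pM permM permMc one => [//|P [|Q [|//]]] _ _ pM _ permMc one.
  by apply: (one P); [apply: pM; rewrite inE eqxx|rewrite /= cats0].
have pP : piece P by apply: pM; rewrite !inE eqxx.
have pQ : piece Q by apply: pM; rewrite !inE eqxx orbT.
rewrite /= cats0 in permMc one.
have [[u [v [uP vQ uv]]]|noend] := pselect (exists u v,
  [/\ u \in [:: head x P; last x P], v \in [:: head x Q; last x Q] & e u v]).
  by have [W] := piece_join pP pQ uP vQ uv; apply: one.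
have : uniq (x :: P ++ Q) by rewrite (perm_uniq permMc).
rewrite /= cat_uniq => /and4P[_ uP /hasPn PQ uQ].
have closed A B : piece A -> piece B -> {in B, forall z, z \notin A} ->
    (forall u v, u \in [:: head x A; last x A] -> v \in [:: head x B; last x B] -> ~~ e u v) ->
    head x A = last x A \/ e (last x A) (head x A).
  move=> pA pB AB nAB; case: (eqVneq (head x A) (last x A)) => [->|hl]; first by left.
  right; case: (pA) (pB) => _ hA lA _ [_ hB _ _].
  have hBB := piece_head_in pB.
  have := nbr_indep3 hA lA hB hl.
  have /negPf -> : ~~ e (head x A) (head x B) by apply: nAB; rewrite !inE eqxx.
  have /negPf -> : ~~ e (last x A) (head x B).
    by apply: nAB; rewrite !inE eqxx ?orbT.
  rewrite !orbF sym_e; apply.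
    by apply: contraTneq (piece_head_in pA) => ->; apply: AB.
  by apply: contraTneq (piece_last_in pA) => ->; apply: AB.
have nPQ u v : u \in [:: head x P; last x P] -> v \in [:: head x Q; last x Q] -> ~~ e u v.
  by move=> uP' vQ'; apply/negP => uv; apply: noend; exists u, v.
have cP : head x P = last x P \/ e (last x P) (head x P) by apply: (closed P Q).
have cQ : head x Q = last x Q \/ e (last x Q) (head x Q).
  apply: (closed Q P) => // [z zP|u v uQ' vP'].
    by apply: contraL zP; apply: PQ.
  by rewrite sym_e; apply: nPQ.
case: (pP) (pQ) => _ hP _ _ [_ hQ _ _].
have [p [q [Np Nq pP' qP pq]]] := conN (mem P) _ _ hP (piece_head_in pP) hQ (PQ _ (piece_head_in pQ)).
have qQ : q \in Q.
  have : q \in x :: P ++ Q by rewrite (perm_mem permMc).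
  rewrite inE mem_cat (negPf (qP : q \notin P)) /= => /predU1P[qx|//].
  by rewrite qx irr_e in Nq.
have [P' [permP hP' sP' lP']] := piece_rotate pP pP' Np cP uP.
have [Q' [permQ hQ' sQ' lQ']] := piece_rotate pQ qQ Nq cQ uQ.
have P'0 : rev P' != [::].
  by rewrite -size_eq0 size_rev size_eq0; apply: contraTneq Np => P0; rewrite -hP' P0 /= irr_e.
have Q'0 : Q' != [::] by apply: contraTneq Nq => Q0; rewrite -hQ' Q0 /= irr_e.
have permW : perm_eq (x :: rev P' ++ Q') c.
  apply: perm_trans permMc; rewrite perm_cons; apply: perm_cat permQ.
  by rewrite perm_rev.
have sW : sorted e (rev P' ++ Q').
  rewrite (sorted_cat _ x P'0 Q'0) last_revE hP' hQ' pq.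
  rewrite (sorted_rev_sym _ sym_e) sP'.
  by rewrite sQ'.
apply: (close_hamiltonian c2 uc allc permW sW).
  by rewrite head_cat_neq // head_revE.
by rewrite last_cat (last_neq_nil _ x).
Qed.

End Hamiltonicity.

End LocalCompletion.

(** * Claw-free and diamond-free graphs with a large clique *)

Definition diamond_free_rel (T : finType) (e : rel T) : Prop :=
  forall x y z u, e x y -> e x z -> e x u -> e y z -> e z u -> y != u -> e y u.

Definition clique (T : finType) (e : rel T) (K : {set T}) : Prop :=
  {in K &, forall u v, u != v -> e u v}.

(** Here [k] and [b] are the sizes of the larger and the smaller clique around a vertex, [t] counts
    the vertices outside the resulting clique of order [k + 1], and n is [k + 1 + t]. With t = s + 6
    the last hypothesis collapses to s k < 6 t. *)
Lemma clique_size_arith (k b t : nat) :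
  51 <= k + 1 + t -> b <= t -> b <= k -> k + 1 + t < k + b + 13 ->
  (2 * (k + 1 + t) - 14) * (k + b) < (k + b) ^ 2 + (k ^ 2 + (t - b) + b * t) ->
  t <= 6.
Proof.
move=> n51 bt bk dn H; rewrite leqNgt; apply/negP => t7.
have [s st] : exists s, t = s + 6 by exists (t - 6); rewrite subnK // ltnW.
have H0 : 2 * (s * k) + 2 * (s * b) + b < b * b + t + b * t.
  move: H; have -> : 2 * (k + 1 + t) - 14 = 2 * k + 2 * s by lia.
  have [r ->] : exists r, t = b + r by exists (t - b); rewrite subnKC.
  by rewrite addKn !expnS !expn0 !muln1; lia.
have bb : b * b <= b * t by rewrite leq_mul2l bt orbT.
have H1 : s * k < 6 * t by move: H0 bb; rewrite st; lia.
(* From s k < 6 s + 36 and s >= 1. As n >= 51, this gives t >= 9 and s >= 3, so the same inequality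
   improves to k <= 17; then t >= 33, against t < b + 12 <= 29. *)
have k41 : k <= 41.
  by rewrite leqNgt; apply/negP => k42; have := leq_mul (leqnn s) k42; lia.
have t9 : 9 <= t by lia.
have k17 : k <= 17.
  rewrite leqNgt; apply/negP => k18; have := leq_mul (leqnn s) k18; lia.
lia.
Qed.

Section LargeClique.
Variables (T : finType) (e : rel T).
Hypotheses (sym_e : symmetric e) (irr_e : irreflexive e).
Hypotheses (claw_e : claw_free_rel e) (diamond_e : diamond_free_rel e).
Local Notation deg v := #|[set y | e v y]|.

(** One part is a neighbour [u0] of [v] with its neighbours in N(v). It is a clique without edges to
    the remainder because there is no diamond; the remainder is a clique because two nonadjacent
    members would form a claw with [u0] at [v]. *)
Lemma neighborhood_cliques v : exists A B : {set T},
  [/\ clique e A, clique e B, A :|: B = [set y | e v y],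
    forall a b, a \in A -> b \in B -> ~~ e a b /\ a != b & #|B| <= #|A|].
Proof.
suff [A [B [cA cB AB nAB]]] : exists A B : {set T},
    [/\ clique e A, clique e B, A :|: B = [set y | e v y] &
      forall a b, a \in A -> b \in B -> ~~ e a b /\ a != b].
  case: (leqP #|B| #|A|) => BA; first by exists A, B.
  exists B, A; split=> //; [by rewrite setUC | | exact: ltnW].
  by move=> b a bB aA; have [ab nab] := nAB a b aA bB; rewrite sym_e eq_sym.
case: (set_0Vmem [set y | e v y]) => [N0|[u0]].
  exists set0, set0; split; rewrite ?setU0 ?N0 //; try by move=> ? ?; rewrite inE.
rewrite inE => vu0.
exists [set y | e v y && ((y == u0) || e u0 y)],
  [set y | e v y && ~~ ((y == u0) || e u0 y)].
split.
- move=> y z; rewrite !inE => /andP[vy yu] /andP[vz zu] yz.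
  case/predU1P: yu => [yu|yu]; case/predU1P: zu => [zu|zu].
  + by rewrite yu zu eqxx in yz.
  + by rewrite yu.
  + by rewrite zu sym_e.
  + by apply: (diamond_e (x := v) (z := u0)); rewrite // sym_e.
- move=> y z; rewrite !inE => /andP[vy /norP[yu uy]] /andP[vz /norP[zu uz]] yz.
  have := claw_e vu0 vy vz; rewrite eq_sym yu eq_sym zu yz (negPf uy) (negPf uz).
  by apply.
- by apply/setP => y; rewrite !inE -andb_orr orbN andbT.
move=> a b; rewrite !inE => /andP[va au] /andP[vb /norP[bu ub]].
have ab : a != b.
  by apply: contraTneq au => ->; rewrite negb_or bu.
split=> //; apply: contra ub => ab'; case/predU1P: au => [<- //|au].
by apply: (diamond_e (x := v) (z := a)); rewrite // eq_sym.
Qed.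

Lemma large_clique v : 51 <= #|T| ->
  (2 * #|T| - 14) * deg v < deg v ^ 2 + \sum_(u | e v u) deg u ->
  exists K : {set T}, [/\ clique e K, #|~: K| <= 6 &
    forall w, w \notin K -> #|[set u in K | e w u]| <= 1].
Proof.
move=> n51 Hv; have [A [B [cA cB AB nAB BA]]] := neighborhood_cliques v.
have disAB : [disjoint A & B].
  rewrite -setI_eq0; apply/eqP/setP => y; rewrite !inE.
  by apply/negP => /andP[yA yB]; have [_] := nAB y y yA yB; rewrite eqxx.
have inN y : (y \in A) || (y \in B) = e v y.
  by have /setP/(_ y) := AB; rewrite !inE.
have vA : v \notin A by apply/negP => vA; have := inN v; rewrite vA irr_e.
have vB : v \notin B by apply/negP => vB; have := inN v; rewrite vB irr_e orbT.
pose K := v |: A.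
have cK : clique e K.
  move=> y z; rewrite !inE => /predU1P[->|yA] /predU1P[->|zA] yz.
  - by rewrite eqxx in yz.
  - by rewrite -inN zA.
  - by rewrite sym_e -inN yA.
  - exact: cA.
have cardK : #|K| = #|A|.+1 by rewrite cardsU1 vA.
have cardW : #|~: K| = #|T| - #|A|.+1 by rewrite -cardK -(cardsC K) addKn.
(* If [w] has two neighbours in [A], the absence of a diamond makes it adjacent to [v]; so it lies
   in [B], which sends no edge to [A]. *)
have one w : w \notin K -> #|[set u in K | e w u]| <= 1.
  rewrite !inE negb_or => /andP[wv wA].
  apply: contraT; rewrite -ltnNge => /card_gt1P[u [u' [uK u'K uu']]].
  have vw_false y : e v w -> y \in A -> e w y -> false.
    rewrite -inN (negPf wA) /= => wB yA wy.
    by have [] := nAB y w yA wB; rewrite sym_e wy.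
  move: uK u'K; rewrite !inE => /andP[/predU1P[uv|uA] wu] /andP[/predU1P[u'v|u'A] wu'].
  - by rewrite uv u'v eqxx in uu'.
  - by apply: (vw_false u'); rewrite // sym_e -uv.
  - by apply: (vw_false u); rewrite // sym_e -u'v.
  apply: (vw_false u) => //.
  have vu : e v u by rewrite -inN uA.
  have vu' : e v u' by rewrite -inN u'A.
  rewrite sym_e in vu; rewrite sym_e in wu; rewrite sym_e in wu'.
  by apply: (diamond_e vu _ wu vu' wu'); [exact: cA|rewrite eq_sym].
exists K; split=> //.
have degd : deg v = #|A| + #|B|.
  by rewrite -AB cardsU disjoint_setI0 // cards0 subn0.
have BW : B \subset ~: K.
  apply/subsetP => y yB; rewrite !inE negb_or.
  have -> /= : y != v by apply: contraNneq vB => <-.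
  by apply/negP => yA; have [_] := nAB y y yA yB; rewrite eqxx.
have bt := subset_leq_card BW.
(* A vertex of [B] has at most one neighbour in [K], and outside [K] it misses at least itself. *)
have sumW : \sum_(u in B) deg u <= #|B| * #|~: K|.
  rewrite -sum_nat_const; apply: leq_sum => w /(subsetP BW).
  rewrite inE => wK; have one_w := one w wK.
  rewrite -(cardsID K) (cardsD1 w (~: K)) inE wK.
  apply: leq_add; last first.
    apply: subset_leq_card; apply/subsetP => y; rewrite !inE => /andP[-> wy].
    by rewrite andbT; apply: contraTneq wy => ->; rewrite irr_e.
  by apply: leq_trans one_w; apply: subset_leq_card; apply/subsetP => y; rewrite !inE andbC.
(* Inside [K] a vertex of [A] has |A| neighbours. Of the outer vertices, those in [B] send no edge
   to [A] and the others at most one. *)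
have sumA : \sum_(u in A) deg u <= #|A| ^ 2 + (#|~: K| - #|B|).
  have split_deg u : u \in A -> deg u <= #|A| + \sum_(w in ~: K) e u w.
    move=> uA; rewrite -(cardsID K) leq_add //.
      rewrite -ltnS -cardK; apply: proper_card; apply/properP; split.
        by apply/subsetP => y; rewrite inE => /andP[].
      by exists u; rewrite !inE ?irr_e ?uA ?orbT.
    rewrite -sum1_card big_mkcond [leqRHS]big_mkcond leq_sum // => y _.
    by rewrite !inE andbC; case: (~~ _); case: (e u y).
  apply: (@leq_trans (\sum_(u in A) (#|A| + \sum_(w in ~: K) e u w))).
    exact: leq_sum.
  rewrite big_split /= sum_nat_const expnS expn1 leq_add2l exchange_big /=.
  rewrite -(cardsDS BW) -sum1_card [leqRHS]big_mkcond [leqLHS]big_mkcond /=.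
  apply: leq_sum => w _; rewrite !inE; case: ifP => // wK; rewrite andbT.
  have wK' : w \notin K by rewrite !inE.
  case: (boolP (w \in B)) => wB /=.
    by rewrite big1 // => u uA; have [/negPf ->] := nAB u w uA wB.
  apply: leq_trans (one w wK'); rewrite -sum1_card [leqLHS]big_mkcond [leqRHS]big_mkcond /=.
  apply: leq_sum => u _; rewrite !inE sym_e; case: (u \in A) => //=.
  by rewrite orbT; case: e.
have dle : \sum_(u | e v u) deg u <= deg v * #|T|.-1.
  rewrite -sum1dep_card big_distrl /=; apply: leq_sum => u _; rewrite mul1n.
  rewrite -ltnS prednK; last by apply/card_gt0P; exists v.
  rewrite -cardsT; apply: proper_card; apply/properP; split; first exact: subsetT.
  by exists u; rewrite !inE // irr_e.
have sumE : \sum_(u | e v u) deg u = \sum_(u in A) deg u + \sum_(u in B) deg u.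
  by rewrite -bigU //=; apply: eq_bigl => u; rewrite inE inN.
have tE : #|A| + 1 + #|~: K| = #|T| by rewrite addn1 -cardK cardsC.
(* Neighbours of [v] have degree at most n - 1, so 2n - 14 < d(v) + n - 1. *)
have nA : #|A| + 1 + #|~: K| < #|A| + #|B| + 13.
  have := leq_trans Hv (leq_add (leqnn _) dle).
  rewrite tE -degd; case: (posnP (deg v)) => [->|d0]; first by rewrite !mul0n muln0.
  have -> : deg v ^ 2 = deg v * deg v by rewrite expnS expn1.
  rewrite -mulnDr mulnC ltn_pmul2l //; lia.
apply: (@clique_size_arith #|A| #|B|) => //; rewrite tE //.
rewrite -degd; apply: leq_trans Hv _; rewrite leq_add2l sumE.
by rewrite leq_add.
Qed.

End LargeClique.

(** * Two-connectedness and systems of ears on a clique *)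

Definition two_connected_rel (T : finType) (e : rel T) : Prop :=
  forall (v : T) (S : {set T}), S != set0 -> v \notin S -> ~: (v |: S) != set0 ->
  exists x y, [/\ x \in S, y \notin S, y != v & e x y].

(** The second edge is found after removing the outer end [y] of the first. Only the outer ends are
    distinct: [x] and [x'] may coincide, which later gives a detour of a single vertex. *)
Lemma two_attachments (T : finType) (e : rel T) (S : {set T}) :
  two_connected_rel e -> S != set0 -> 1 < #|~: S| ->
  exists x y x' y', [/\ x \in S, y \notin S, x' \in S, y' \notin S & [/\ e x y, e x' y' & y != y']].
Proof.
move=> conn S0 cS.
have compl v : v \notin S -> ~: (v |: S) != set0.
  move=> vS; rewrite -card_gt0 setCU setIC -setDE.
  by move: cS; rewrite (cardsD1 v) inE vS.
have [v] : exists v, v \in ~: S by apply/set0Pn; rewrite -card_gt0 ltnW.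
rewrite inE => vS; have [x [y [xS yS _ xy]]] := conn v S S0 vS (compl v vS).
have [x' [y' [x'S y'S y'y x'y']]] := conn y S S0 yS (compl y yS).
by exists x, y, x', y'; split=> //; split=> //; rewrite eq_sym.
Qed.

(** Disjointness after an exchange of ears is checked through multiplicities, which turns it into
    linear arithmetic over [count_mem]. *)
Lemma count_le_uniq (T : eqType) (s t : seq T) :
  (forall x, count_mem x s <= count_mem x t) -> uniq t -> uniq s.
Proof.
move=> st ut; elim: s st => //= a s IH st; apply/andP; split.
  apply/count_memPn; have := st a; rewrite eqxx (count_uniq_mem a ut).
  by case: (a \in t); case: count.
by apply: IH => x; apply: leq_trans (leq_addl _ _) (st x).
Qed.

Ltac goal_lia :=
  repeat match goal with H : ?P |- _ =>
    match type of P with Prop => clear H end end;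
  lia.

Ltac count_lia :=
  repeat match goal with |- context [nat_of_bool ?b] =>
    let k := fresh in move: (nat_of_bool b) => k end;
  repeat match goal with |- context [count ?a ?s] =>
    let k := fresh in move: (count a s) => k end;
  goal_lia.

Ltac count_solve :=
  let x := fresh in move=> x;
  rewrite -?cats1 ?count_cat /= ?count_cat /= ?count_cat /= ?count_rev; count_lia.

Section Ears.
Variables (T : finType) (e : rel T).
Hypotheses (sym_e : symmetric e) (irr_e : irreflexive e).
Hypotheses (claw_e : claw_free_rel e) (diamond_e : diamond_free_rel e).
Hypothesis conn_e : two_connected_rel e.
Variable K : {set T}.
Hypotheses (cK : clique e K) (K_ge3 : 3 <= #|K|).
Hypothesis one_nbr : forall w, w \notin K -> #|[set u in K | e w u]| <= 1.

Lemma K_nbr_uniq w k k' : w \notin K -> k \in K -> k' \in K -> e w k -> e w k' -> k = k'.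
Proof.
move=> wK kK k'K wk wk'; apply/eqP; apply: contraT => kk'.
have := one_nbr wK; rewrite leqNgt => /negP[]; apply/card_gt1P.
by exists k, k'; rewrite !inE kK k'K.
Qed.

(** Any further clique vertex [k'] is adjacent neither to [w] nor to [w'], whose only neighbour in
    [K] is [k]; hence [w] and [w'] must be adjacent to avoid a claw at [k]. *)
Lemma K_attached_clique k w w' : k \in K -> w \notin K -> w' \notin K -> w != w' ->
  e k w -> e k w' -> e w w'.
Proof.
move=> kK wK w'K ww' kw kw'.
have [k' k'K] : exists k', k' \in K :\ k.
  by apply/set0Pn; rewrite -card_gt0; move: K_ge3; rewrite (cardsD1 k) kK; case: #|_|.
move: k'K; rewrite !inE => /andP[k'k k'K].
have nk' v : v \notin K -> e k v -> ~~ e k' v.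
  move=> vK kv; apply: contraNN k'k => k'v; apply/eqP.
  by apply: (K_nbr_uniq vK); rewrite // sym_e.
have kk' : e k k' by rewrite cK // eq_sym.
have := claw_e kk' kw kw'; rewrite (negPf (nk' _ wK kw)) (negPf (nk' _ w'K kw')) ww' /=.
by apply => //; apply: contraTneq k'K => ->.
Qed.

Definition ear_type := (T * seq T * T)%type.
(** The lock keeps the vertex list of an ear from unfolding under [/=], so that counting goes
    through [count_els]. *)
Fact els_key : unit. Proof. by []. Qed.
Definition els (E : ear_type) : seq T :=
  locked_with els_key (E.1.1 :: rcons E.1.2 E.2).

Lemma elsE E : els E = E.1.1 :: rcons E.1.2 E.2.
Proof. by rewrite /els unlock. Qed.

(** That the two ends differ is imposed by [uniq] in [ears], which covers all vertices of the
    system, ends included. *)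
Definition ear (E : ear_type) : bool :=
  [&& E.1.1 \in K, E.2 \in K, path e E.1.1 (rcons E.1.2 E.2),
    all (fun x => x \notin K) E.1.2 & E.1.2 != [::]].
Definition mids (L : seq ear_type) : seq T := flatten [seq E.1.2 | E <- L].
Definition ears (L : seq ear_type) : bool := all ear L && uniq (flatten (map els L)).
Definition rev_ear (E : ear_type) : ear_type := (E.2, rev E.1.2, E.1.1).

Lemma count_els x E :
  count_mem x (els E) = (E.1.1 == x) + count_mem x E.1.2 + (E.2 == x).
Proof. by rewrite elsE /= -cats1 count_cat /= addn0 addnA. Qed.

Lemma els_rev E : els (rev_ear E) = rev (els E).
Proof. by case: E => [[a p] b]; rewrite !elsE /= rev_cons rev_rcons. Qed.

Lemma ear_rev E : ear (rev_ear E) = ear E.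
Proof.
case: E => [[a p] b]; rewrite /ear /=.
rewrite all_rev -!size_eq0 size_rev andbCA; congr [&& _, _, _ & _].
have -> : path e b (rcons (rev p) a) = sorted e (rev (a :: rcons p b)).
  by rewrite rev_cons rev_rcons.
by rewrite sorted_rev_sym.
Qed.

Lemma ear_hamiltonian L : ears L -> (forall w, w \notin K -> w \in mids L) ->
  hamiltonian_rel e.
Proof.
case/andP=> earL uL covL.
pose rest := [seq k <- enum T | (k \in K) && (k \notin flatten (map els L))].
pose c := flatten (map els L) ++ rest.
have u_rest : uniq rest by rewrite filter_uniq ?enum_uniq.
have uc : uniq c.
  rewrite cat_uniq uL u_rest andbT; apply/hasPn => x.
  by rewrite mem_filter => /andP[/andP[]].
have allc x : x \in c.
  rewrite mem_cat mem_filter mem_enum andbT.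
  case: (boolP (x \in _)) => //= xL; rewrite andbT; apply: contraNT xL => xK.
  have /flattenP[p /mapP[E EL ->] xE] := covL x xK.
  apply/flattenP; exists (els E); first exact: map_f.
  by rewrite elsE inE mem_rcons inE xE !orbT.
have c3 : 2 < size c.
  rewrite -(card_uniqP uc); apply: leq_trans K_ge3 _.
  by apply: subset_leq_card; apply/subsetP.
have [x0 _] : exists x, x \in K by apply/card_gt0P; apply: leq_trans K_ge3.
have glue s t : s != [::] -> t != [::] -> uniq (s ++ t) -> sorted e s -> sorted e t ->
    last x0 s \in K -> head x0 t \in K -> sorted e (s ++ t).
  move=> s0 t0 ust ss st ls ht; rewrite (sorted_cat _ x0) // ss st /=.
  apply: cK => //; move: ust; rewrite cat_uniq => /and3P[_ /hasPn/(_ (head x0 t)) + _].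
  case: t t0 {st ht} => //= b t _ /(_ (mem_head _ _)); apply: contraNneq => <-.
  by case: s s0 {ss ls} => //= a s _; rewrite mem_last.
have sorted_rest : sorted e rest /\ (rest != [::] -> head x0 rest \in K /\ last x0 rest \in K).
  have : all (fun k => k \in K) rest.
    by apply/allP => k; rewrite mem_filter => /andP[/andP[]].
  elim: rest u_rest {c uc allc c3} => // k r IH /= /andP[kr ur] /andP[kK rK].
  have [sr hr] := IH ur rK; case: r kr ur rK sr hr {IH} => [|k' r] //= kr ur rK sr hr.
  have [k'K lK] := hr isT; split=> //; rewrite sr andbT.
  by apply: cK => //; move: kr; rewrite inE negb_or => /andP[].
have [sc hlc] : sorted e c /\ head x0 c \in K /\ last x0 c \in K.
  have c0 : c != [::] by rewrite -size_eq0 -lt0n; apply: leq_trans c3.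
  suff key M : all ear M -> uniq (flatten (map els M) ++ rest) ->
      let d := flatten (map els M) ++ rest in
      sorted e d /\ (d != [::] -> head x0 d \in K /\ last x0 d \in K).
    by have [sc /(_ c0)] := key L earL uc.
  elim: M => [|E M IH]; first by [].
  have -> : flatten (map els (E :: M)) ++ rest = els E ++ (flatten (map els M) ++ rest).
    by rewrite catA.
  move=> /andP[eE eM] uEM.
  have uM : uniq (flatten (map els M) ++ rest).
    by move: uEM; rewrite cat_uniq => /and3P[].
  have [sM hM] := IH eM uM; move: uEM sM hM; set d := flatten _ ++ rest.
  move=> uEM sM hM dd; rewrite {}/dd; case/and5P: (eE) => aK bK pE _ _.
  have lE : last x0 (els E) = E.2 by rewrite elsE /= last_rcons.
  have [d0|d0] := eqVneq d [::].
    by rewrite d0 cats0 lE elsE.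
  have [hd ld] := hM d0; split; first by apply: glue; rewrite ?lE // elsE.
  by move=> _; rewrite last_cat (last_neq_nil _ x0) // elsE.
exists c; split=> //; rewrite /ucycle uc andbT.
case: c sc hlc c3 uc {allc} => // k c /= sc [hK lK] c3 uc.
rewrite rcons_path sc /=; apply: cK => //.
by case: c uc c3 {sc lK} => //= k' c /andP[kc _] _; apply: contraNneq kc => <-; rewrite mem_last.
Qed.

Lemma mids_uniq L : ears L -> uniq (mids L) /\ {in mids L, forall w, w \notin K}.
Proof.
case/andP=> eL uL; split.
  apply: count_le_uniq uL => x; rewrite /mids; elim: L {eL} => //= E L IH.
  by rewrite !count_cat count_els; move: IH; count_lia.
move=> w /flattenP[p /mapP[E EL ->]].
by have /and5P[_ _ _ /allP pK _] := allP eL E EL; apply: pK.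
Qed.

(** The edges a_i b_i of EP_n are left open: the net is meant to exhibit a spanning subgraph of
    EP_n, and the comparison of q supplies the remaining edges. *)
Definition net a1 b1 c1 a2 b2 c2 a3 b3 c3 : Prop :=
  [/\ uniq [:: b1; c1; b2; c2; b3; c3] /\ ~: K =i [:: b1; c1; b2; c2; b3; c3],
    uniq [:: a1; a2; a3] /\ all (fun x => x \in K) [:: a1; a2; a3],
    [/\ e a1 c1, e a2 c2 & e a3 c3], [/\ e c1 b1, e c2 b2 & e c3 b3] &
    [/\ e b1 b2, e b1 b3 & e b2 b3]].

Section MaximalSystem.
Variable L : seq ear_type.
Hypotheses (earsL : ears L).
Hypothesis maxL : forall M, ears M -> size (mids M) <= size (mids L).
Local Notation cov := (flatten (map els L)).

(* [L0] is a subsystem of [L], up to the orientation of the ears. *)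
Definition part (L0 : seq ear_type) : Prop := exists L1,
  [/\ all ear L0, all ear L1,
    perm_eq cov (flatten (map els L0) ++ flatten (map els L1)) &
    size (mids L) = size (mids L0) + size (mids L1)].

Lemma mids_cat L0 L1 : mids (L0 ++ L1) = mids L0 ++ mids L1.
Proof. by rewrite /mids map_cat flatten_cat. Qed.

Lemma part_ears L0 : part L0 -> ears L0.
Proof.
case=> L1 [e0 _ perm _]; rewrite /ears e0.
by case/andP: earsL => _; rewrite (perm_uniq perm) cat_uniq => /and3P[].
Qed.

(** The exchange principle: [N] spends only vertices of [L0] and uncovered ones from [extra], so
    with the remaining ears it forms a system again, and the maximality of [L] applies. *)
Lemma part_swap L0 N extra : part L0 -> all ear N -> uniq extra ->
  {in extra, forall x, x \notin cov} ->
  (forall x, count_mem x (flatten (map els N)) <=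
             count_mem x (flatten (map els L0) ++ extra)) ->
  size (mids N) <= size (mids L0).
Proof.
case=> L1 [e0 e1 perm sz] eN uX XL cN.
rewrite -(leq_add2r (size (mids L1))) -sz -size_cat -mids_cat maxL //.
rewrite /ears all_cat eN e1 /= map_cat flatten_cat.
apply: (@count_le_uniq _ _ (cov ++ extra)) => [x|].
  have /permP/(_ (pred1 x)) := perm; have := cN x; rewrite !count_cat; count_lia.
rewrite cat_uniq uX andbT; case/andP: earsL => _ -> /=.
by apply/hasPn => x /XL.
Qed.

Lemma part_rev E L0 : part (E :: L0) -> part (rev_ear E :: L0).
Proof.
case=> L1 [/= /andP[eE e0] e1 perm sz]; exists L1; split=> //=.
- by rewrite ear_rev eE.
- apply: perm_trans perm _; rewrite /= -!catA perm_cat2r els_rev.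
  by rewrite perm_sym perm_rev.
- by move: sz; rewrite /mids /= !size_cat size_rev.
Qed.

Lemma part_perm L0 L0' : perm_eq L0 L0' -> part L0 -> part L0'.
Proof.
move=> p0 [L1 [e0 e1 perm sz]]; exists L1; split=> //.
- by rewrite -(perm_all _ p0).
- by apply: perm_trans perm _; rewrite perm_cat2r; apply/perm_flatten/perm_map.
- by rewrite sz; congr (_ + _); apply/perm_size/perm_flatten/perm_map.
Qed.

Lemma part1 E : E \in L -> part [:: E].
Proof.
move=> EL; have pE := perm_to_rem EL; exists (rem E L); case/andP: earsL => eL _.
rewrite (perm_all _ pE) in eL; case/andP: eL => eE eR; split=> //=.
- by rewrite eE.
- by rewrite cats0; apply: (perm_flatten (perm_map els pE)).
- rewrite -size_cat -mids_cat; apply/perm_size/perm_flatten/perm_map; exact: pE.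
Qed.

Lemma part2 E E' : E \in L -> E' \in L -> E != E' -> part [:: E; E'].
Proof.
move=> EL E'L EE'; have pE := perm_to_rem EL.
have pE' : perm_eq L (E :: E' :: rem E' (rem E L)).
  rewrite (permPl pE) perm_cons; apply: perm_to_rem.
  by move: E'L; rewrite (perm_mem pE) inE eq_sym (negPf EE').
exists (rem E' (rem E L)); case/andP: earsL => eL _.
rewrite (perm_all _ pE') in eL; case/and3P: eL => eE eE' eR; split=> //=.
- by rewrite eE eE'.
- by rewrite cats0 -catA; apply: (perm_flatten (perm_map els pE')).
- rewrite -size_cat -mids_cat; apply/perm_size/perm_flatten/perm_map; exact: pE'.
Qed.

Lemma ear_catE a u y v b : ear (a, u ++ y :: v, b) =
  [&& a \in K, b \in K, path e a u, e (last a u) y, path e y (rcons v b),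
    all (fun x => x \notin K) u, y \notin K & all (fun x => x \notin K) v].
Proof.
rewrite /ear /= rcons_cat cat_path /= all_cat /=.
by rewrite (_ : u ++ y :: v != [::]) ?andbT -?andbA //; case: u.
Qed.

(** Were [s] adjacent to an ear neighbour of [y], it could be inserted between the two. To avoid a
    claw at [y], its two ear neighbours are therefore adjacent, and the ear survives the removal of
    [y]. *)
Lemma no_insertion a u y v b s : part [:: (a, u ++ y :: v, b)] ->
  s \notin K -> s \notin cov -> e y s ->
  [/\ ~~ e s (last a u), ~~ e s (head b v) & e (last a u) (head b v)].
Proof.
move=> pE sK scov ys; have /andP[] := part_ears pE.
rewrite all_seq1 ear_catE => /and5P[aK bK pu uy /and4P[yv uK yK vK]].
rewrite [map _ _]/= [flatten _]/= cats0 => uE.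
have [n1 n2] : ~~ e s (last a u) /\ ~~ e s (head b v).
  split; apply/negP => h.
    have us : e (last a u) s by rewrite sym_e.
    have sy : e s y by rewrite sym_e.
    have := @part_swap _ [:: (a, u ++ s :: y :: v, b)] [:: s] pE.
    rewrite all_seq1 ear_catE aK bK pu us /= sy yv uK sK yK vK.
    have cx x : x \in [:: s] -> x \notin cov by rewrite inE => /eqP ->.
    move=> /(_ isT isT cx); rewrite /mids /= !cats0 !size_cat /= !addnS ltnn => H.
    suff: false by []. apply: H => x; rewrite !count_cat !count_els /= !count_cat /=; count_lia.
  have := @part_swap _ [:: (a, u ++ y :: s :: v, b)] [:: s] pE.
  have sv : path e s (rcons v b) by case: v h yv {uE vK pE} => /= [->|k v -> /andP[_ ->]].
  rewrite all_seq1 ear_catE aK bK pu uy /= ys sv uK sK yK vK.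
  have cx x : x \in [:: s] -> x \notin cov by rewrite inE => /eqP ->.
  move=> /(_ isT isT cx); rewrite /mids /= !cats0 !size_cat /= !addnS ltnn => H.
  suff: false by []. apply: H => x; rewrite !count_cat !count_els /= !count_cat /=; count_lia.
split=> //.
have yb : e y (head b v) by case: v yv {n2 pE vK uE} => /= [|k v]; case/andP.
have yu : e y (last a u) by rewrite sym_e.
have uE' : uniq ((a :: u) ++ y :: rcons v b).
  by move: uE; rewrite elsE /= rcons_cat.
have lu : last a u \in a :: u by rewrite mem_last.
have hv : head b v \in rcons v b by case: (v) => [|k w] /=; rewrite inE eqxx.
have := claw_e ys yu yb; rewrite (negPf n1) (negPf n2) /=; apply.
- apply: contraNneq scov => ->; have [L1 [_ _ perm _]] := pE.
  rewrite (perm_mem perm) mem_cat /= cats0 elsE /= rcons_cat -cat_cons mem_cat.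
  by rewrite lu.
- apply: contraNneq scov => ->; have [L1 [_ _ perm _]] := pE.
  rewrite (perm_mem perm) mem_cat /= cats0 elsE /= rcons_cat -cat_cons mem_cat.
  by rewrite /= [_ \in y :: _]inE hv !orbT.
move: uE'; rewrite cat_uniq => /and3P[_ /hasPn/(_ (head b v)) + _].
by rewrite inE hv orbT => /(_ isT); apply: contraNneq => <-.
Qed.

Lemma part_swap1 a p b a' p' b' extra : part [:: (a, p, b)] -> ear (a', p', b') ->
  uniq extra -> {in extra, forall x, x \notin cov} ->
  (forall x, (a' == x) + count_mem x p' + (b' == x) <=
    (a == x) + count_mem x p + (b == x) + count_mem x extra) ->
  size p' <= size p.
Proof.
move=> pE eE' uX XL cN; have := @part_swap _ [:: (a', p', b')] extra pE.
rewrite all_seq1 => /(_ eE' uX XL); rewrite /mids /= !cats0; apply => x.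
by rewrite count_cat !count_els.
Qed.

Lemma part_swap2 a p b c q d a' p' b' extra :
  part [:: (a, p, b); (c, q, d)] -> ear (a', p', b') ->
  uniq extra -> {in extra, forall x, x \notin cov} ->
  (forall x, (a' == x) + count_mem x p' + (b' == x) <=
    (a == x) + count_mem x p + (b == x) +
    ((c == x) + count_mem x q + (d == x)) + count_mem x extra) ->
  size p' <= size p + size q.
Proof.
move=> pE eE' uX XL cN; have := @part_swap _ [:: (a', p', b')] extra pE.
rewrite all_seq1 => /(_ eE' uX XL); rewrite /mids /= !cats0 size_cat; apply => x.
by rewrite !count_cat !count_els.
Qed.

Definition detour s r : Prop := [/\ path e s r, uniq (s :: r),
  {in s :: r, forall x, x \notin K} & {in s :: r, forall x, x \notin cov}].

Lemma detour_rev s r : detour s r -> detour (last s r) (rev (belast s r)).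
Proof.
have E : last s r :: rev (belast s r) = rev (s :: r) by rewrite [in RHS]lastI rev_rcons.
rewrite /detour E => -[pr ur rK rcov]; split.
- have : sorted e (rev (s :: r)) by rewrite sorted_rev_sym.
  by rewrite -E.
- by rewrite rev_uniq.
- by move=> x; rewrite mem_rev; apply: rK.
- by move=> x; rewrite mem_rev; apply: rcov.
Qed.

Lemma last_rev_belast (s : T) r : last (last s r) (rev (belast s r)) = s.
Proof. by case: r => //= t r; rewrite rev_cons last_rcons. Qed.

Lemma detour_extra s r c : detour s r -> c \in K -> c \notin cov ->
  uniq (rcons (s :: r) c) /\ {in rcons (s :: r) c, forall x, x \notin cov}.
Proof.
case=> _ ur rK rcov cK' ccov; split.
  rewrite rcons_uniq ur andbT; apply: contraL cK' => /rK //.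
by move=> x; rewrite mem_rcons inE => /predU1P[->|/rcov].
Qed.

(* [y] is taken out of its place between [u] and [v], which [no_insertion]
   closes up, and the ear is led from [y] along the detour to [c]. *)
Lemma free_end_half a u y v b s r c : part [:: (a, u ++ y :: v, b)] ->
  detour s r -> e y s -> c \in K -> c \notin cov -> e (last s r) c ->
  size (s :: r) < size v.
Proof.
move=> pE dr ys cK' ccov rc; have [uX XL] := detour_extra dr cK' ccov.
have [pr ur rK rcov] := dr; have s_in : s \in s :: r by rewrite mem_head.
have sK := rK s s_in.
have [_ _ shortcut] := no_insertion pE sK (rcov s s_in) ys.
have /andP[] := part_ears pE; rewrite all_seq1 ear_catE.
move=> /and5P[aK bK pu uy /and4P[yv uK yK vK]] _.
have rK' : all (fun x => x \notin K) r.
  by apply/allP => x xr; apply: rK; rewrite inE xr orbT.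
case: v => [|v1 v] in pE shortcut yv vK *.
  have : size (u ++ y :: s :: r) <= size (u ++ [:: y]).
    apply: (part_swap1 (a' := a) (b' := c) pE _ uX XL).
      by rewrite ear_catE aK cK' pu uy /= ys rcons_path pr rc uK yK sK.
    by count_solve.
  by rewrite !size_cat /=; goal_lia.
(* The part of [v] beyond [v1] and the end [b] are given up; the detour and the end [c] are
   gained. *)
have : size ((u ++ [:: v1]) ++ y :: s :: r) <= size (u ++ y :: v1 :: v).
  apply: (part_swap1 (a' := a) (b' := c) pE _ uX XL).
    move: yv vK => /= /andP[yv1 _] /andP[v1K _].
    rewrite ear_catE aK cK' cat_path pu /= shortcut last_cat /= sym_e yv1 ys.
    by rewrite rcons_path pr rc all_cat uK /= v1K yK sK.
  by count_solve.
by rewrite !size_cat /=; goal_lia.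
Qed.

Lemma rev_ear_cat a u y v b :
  rev_ear (a, u ++ y :: v, b) = (b, rev v ++ y :: rev u, a).
Proof. by rewrite /rev_ear /= rev_cat rev_cons cat_rcons. Qed.

Lemma free_end a u y v b s r c : part [:: (a, u ++ y :: v, b)] ->
  detour s r -> e y s -> c \in K -> c \notin cov -> e (last s r) c ->
  size (s :: r) < size v /\ size (s :: r) < size u.
Proof.
move=> pE dr ys cK' ccov rc; split; first exact: (free_end_half pE dr ys cK' ccov rc).
have := part_rev pE; rewrite rev_ear_cat => pE'.
by have := free_end_half pE' dr ys cK' ccov rc; rewrite size_rev.
Qed.

Lemma detour_uniq L0 s r : part L0 -> detour s r ->
  uniq (mids L0 ++ s :: r) /\ {in mids L0 ++ s :: r, forall x, x \notin K}.
Proof.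
move=> pL [_ ur rK rcov]; have [u0 K0] := mids_uniq (part_ears pL).
split; last by move=> x; rewrite mem_cat => /orP[/K0|/rK].
rewrite cat_uniq u0 ur andbT; apply/hasPn => x /rcov; apply: contra.
case: pL => L1 [_ _ perm _]; rewrite (perm_mem perm) mem_cat => xL; apply/orP; left.
have /flattenP[p /mapP[E EL ->] xE] := xL; apply/flattenP; exists (els E).
  exact: map_f.
by rewrite elsE inE mem_rcons inE xE !orbT.
Qed.

Lemma part_catl L0 L0' : part (L0 ++ L0') -> part L0.
Proof.
case=> L1 [e0 e1 perm sz]; exists (L0' ++ L1); move: e0; rewrite all_cat => /andP[e0 e0'].
split=> //; first by rewrite all_cat e0' e1.
  by move: perm; rewrite !map_cat !flatten_cat catA.
by rewrite sz !mids_cat !size_cat addnA.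
Qed.

Lemma part_catr L0 L0' : part (L0 ++ L0') -> part L0'.
Proof. by move=> /(part_perm (permEl (perm_catC _ _))) /part_catl. Qed.

(** For empty [u], the first ear goes on from [y] along the detour to [y'] and through [v] to [d].
    For single [u] and [v], adjacent by [no_insertion], it goes from [y'] back to [u] and then
    through [v] to [d]. No interior vertex is lost; the ends [b] and [c] are released. *)
Lemma merge_ears_half a p1 y b c u y' v d s r :
  part [:: (a, [:: p1; y], b); (c, u ++ y' :: v, d)] ->
  detour s r -> e y s -> e (last s r) y' -> 
  u = [::] \/ size u = 1 /\ size v = 1 -> False.
Proof.
move=> pL dr ys ry' uv; have [pr ur rK rcov] := dr.
have s_in : s \in s :: r by rewrite mem_head.
have l_in : last s r \in s :: r by rewrite mem_last.
have pE' : part [:: (c, u ++ y' :: v, d)] by exact: (@part_catr [:: (a, [:: p1; y], b)] _ pL).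
have sK := rK s s_in; have rK' : all (fun x => x \notin K) r.
  by apply/allP => x xr; apply: rK; rewrite inE xr orbT.
have y'r : e y' (last s r) by rewrite sym_e.
have [_ _ shortcut] := no_insertion pE' (rK _ l_in) (rcov _ l_in) y'r.
have /andP[] := part_ears pL.
rewrite /= -[[:: p1; y]]/([:: p1] ++ [:: y]) !ear_catE.
move=> /and3P[/and5P[aK bK /= /andP[ap1 _] p1y /and4P[yb /andP[p1K _] yK _]]].
move=> /and5P[cK' dK pu uy' /and4P[y'v uK y'K vK]] _ _.
case: u => [|u1' u] in uv pL pE' shortcut pu uy' uK *.
  have : size ([:: p1] ++ y :: s :: r ++ y' :: v) <= size [:: p1; y] + size (y' :: v).
    apply: (part_swap2 (a' := a) (b' := d) pL _ ur rcov); last by count_solve.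
    rewrite ear_catE aK dK /= ap1 p1y ys rcons_cat cat_path pr /= ry' y'v.
    by rewrite p1K yK sK all_cat rK' /= y'K vK.
  by rewrite /= size_cat /=; goal_lia.
case: uv => [//|[[/size0nil u0] v1]]; rewrite {u}u0 in pL pE' shortcut pu uy' uK.
case: v v1 => [|v1' [|//]] // _ in pL pE' shortcut y'v vK *.
have : size ([:: p1] ++ y :: s :: r ++ [:: y'; u1'; v1']) <= size [:: p1; y] + size [:: u1'; y'; v1'].
  apply: (part_swap2 (a' := a) (b' := d) pL _ ur rcov); last by count_solve.
  rewrite ear_catE aK dK /= ap1 p1y ys rcons_cat cat_path pr /= ry'.
  move: uK vK y'v shortcut uy' => /= /andP[u1K _] /andP[v1K _] /and3P[_ v1d _] uv1 uy'.
  by rewrite sym_e uy' uv1 v1d p1K yK sK all_cat rK' /= y'K u1K v1K.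
by rewrite /= size_cat /=; goal_lia.
Qed.

(** Reversing the first ear puts [y] next to [b]. The bound on [u] and [v] leaves three cases: one
    of them is empty, up to reversing the second ear, or both are single vertices. *)
Lemma merge_ears a p b c u y' v d y s r :
  part [:: (a, p, b); (c, u ++ y' :: v, d)] -> y \in p -> size p = 2 ->
  size u + size v <= 2 -> detour s r -> e y s -> e (last s r) y' -> False.
Proof.
move=> pL yp p2 uv2 dr ys ry'.
wlog [p1 pE] : a p b yp p2 pL / exists p1, p = [:: p1; y].
  move=> H; case: p => [|p1 [|p2' [|//]]] // in p2 yp pL *.
  move: yp; rewrite !inE => /orP[]/eqP yE; last first.
    by apply: (H a [:: p1; p2'] b) => //; [rewrite yE !inE eqxx orbT|exists p1; rewrite yE].
  by apply: (H b [:: p2'; p1] a) => //; [rewrite yE !inE eqxx orbT|exact: part_rev pL|exists p2'; rewrite yE].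
rewrite pE in pL.
have pL' : part [:: (a, [:: p1; y], b); (d, rev v ++ y' :: rev u, c)].
  rewrite -rev_ear_cat.
  have := part_perm (permEl (perm_catC [:: _] [:: _])) pL => /part_rev.
  by move/(part_perm (permEl (perm_catC [:: _] [:: _]))).
case: (posnP (size u)) => [/size0nil u0|u0].
  by apply: (merge_ears_half pL dr ys ry'); left.
case: (posnP (size v)) => [/size0nil v0|v0].
  by apply: (merge_ears_half pL' dr ys ry'); left; rewrite v0.
apply: (merge_ears_half pL dr ys ry'); right; move: uv2 u0 v0.
by case: (size u) => [|[|[]]] //; case: (size v) => [|[|]].
Qed.

(** A shorter gap can be absorbed: for empty [v] the detour goes in between; a single vertex moves
    in front of [y]; of two vertices, the first moves in front of [y] and the second behind [y'].
    The new edges come from [no_insertion]. *)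
Lemma same_ear a u y v y' w b s r : part [:: (a, u ++ y :: v ++ y' :: w, b)] ->
  detour s r -> e y s -> e (last s r) y' -> 2 < size v.
Proof.
move=> pL dr ys ry'; have [pr ur rK rcov] := dr.
have s_in : s \in s :: r by rewrite mem_head.
have l_in : last s r \in s :: r by rewrite mem_last.
have sK := rK s s_in; have rK' : all (fun x => x \notin K) r.
  by apply/allP => x xr; apply: rK; rewrite inE xr orbT.
have [_ _ cut] := no_insertion pL sK (rcov s s_in) ys.
have pL' : part [:: (a, (u ++ y :: v) ++ y' :: w, b)] by rewrite -catA.
have y'r : e y' (last s r) by rewrite sym_e.
have [_ _ cut'] := no_insertion pL' (rK _ l_in) (rcov _ l_in) y'r.
have := part_ears pL'; rewrite /ears all_seq1 ear_catE => /andP[].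
rewrite cat_path /= last_cat all_cat /=.
move=> /and5P[aK bK /and3P[pu uy yv] vy' /and4P[y'w /and3P[uK yK vK] y'K wK]] _.
case: v => [|v1 [|v2 [|//]]] in pL pL' cut cut' yv vy' vK *.
- have : size (u ++ y :: s :: r ++ y' :: w) <= size (u ++ y :: [::] ++ y' :: w).
    apply: (part_swap1 (a' := a) (b' := b) pL _ ur rcov); last by count_solve.
    rewrite ear_catE aK bK pu uy /= ys rcons_cat cat_path pr /= ry' y'w.
    by rewrite uK yK sK all_cat rK' /= y'K wK.
  by rewrite !size_cat /= !size_cat /=; goal_lia.
- have : size ((u ++ [:: v1]) ++ y :: s :: r ++ y' :: w) <= size (u ++ y :: [:: v1] ++ y' :: w).
    apply: (part_swap1 (a' := a) (b' := b) pL _ ur rcov); last by count_solve.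
    move: cut yv vK => /= cut /andP[yv1 _] /andP[v1K _].
    rewrite ear_catE aK bK cat_path pu last_cat /= cut sym_e yv1 ys rcons_cat cat_path pr /= ry' y'w.
    by rewrite all_cat uK /= v1K yK sK all_cat rK' /= y'K wK.
  by rewrite !size_cat /= !size_cat /=; goal_lia.
have : size ((u ++ [:: v1]) ++ y :: s :: r ++ [:: y', v2 & w]) <=
    size (u ++ y :: [:: v1; v2] ++ y' :: w).
  apply: (part_swap1 (a' := a) (b' := b) pL _ ur rcov); last by count_solve.
  move: cut cut' yv vy' vK => /= cut cut' /and3P[yv1 _ _] v2y' /and3P[v1K v2K _].
  rewrite last_cat /= in cut'.
  have v2w : path e v2 (rcons w b).
    by case: (w) y'w cut' => [|k w'] /= => [_ ->|/andP[_ ->] ->].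
  rewrite ear_catE aK bK cat_path pu last_cat /= cut sym_e yv1 ys rcons_cat cat_path pr /= ry'.
  by rewrite sym_e v2y' v2w all_cat uK /= v1K yK sK all_cat rK' /= y'K v2K wK.
by rewrite !size_cat /= !size_cat /=; goal_lia.
Qed.

(** Both [s] and the first interior vertex of the ear are outer neighbours of [k], hence adjacent,
    and [s] fits between [k] and that vertex. *)
Lemma used_end_half k p b s : part [:: (k, p, b)] -> s \notin K -> s \notin cov -> e k s -> False.
Proof.
move=> pL sK scov ks; have := part_ears pL; rewrite /ears all_seq1.
case/andP => /and5P[/= kK bK kp pK p0] _.
case: p => [//|p1 p] in pL kp pK p0 *; move: kp pK => /= /andP[kp1 p1b] /andP[p1K pK].
have p1s : s != p1.
  apply: contraNneq scov => ->; case: pL => L1 [_ _ perm _].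
  by rewrite (perm_mem perm) mem_cat /= elsE !inE eqxx orbT.
have : size [:: s, p1 & p] <= size (p1 :: p).
  have us : uniq [:: s] by [].
  apply: (part_swap1 (a' := k) (b' := b) pL _ us); last by count_solve.
    rewrite /ear /= kK bK ks (K_attached_clique kK sK p1K) // p1b sK p1K pK //.
  by move=> x; rewrite inE => /eqP ->.
by rewrite /= ltnn.
Qed.

Lemma used_end k s : k \in K -> k \in cov -> s \notin K -> s \notin cov -> e k s -> False.
Proof.
move=> kK /flattenP[_ /mapP[E EL ->]] kE sK scov ks.
have := part1 EL; case: E EL kE => [[a p] b] EL; rewrite elsE inE mem_rcons inE /= => kE pL.
case/or3P: kE => [/eqP ka|/eqP kb|kp].
- by rewrite -ka in pL; apply: used_end_half pL sK scov ks.
- by have := part_rev pL; rewrite /rev_ear /= -kb => /used_end_half; apply; eassumption.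
have := part_ears pL; rewrite /ears all_seq1 => /andP[/and5P[_ _ _ /= /allP/(_ k kp)]].
by rewrite kK.
Qed.

(** A single interior vertex would have two neighbours in [K]. *)
Lemma ear_size a p b : part [:: (a, p, b)] -> 1 < size p.
Proof.
move=> pL; have := part_ears pL; rewrite /ears all_seq1 => /andP[/and5P[/= aK bK pab pK p0]].
rewrite cats0 elsE /= => /andP[ab _].
case: p => [|p1 [|//]] // in pL pab pK p0 ab *; move: pab pK => /= /and3P[ap1 p1b _] /andP[p1K _].
have := K_nbr_uniq p1K aK bK; rewrite sym_e ap1 => /(_ isT p1b) abE.
by move: ab; rewrite abE mem_rcons mem_head.
Qed.

Lemma no_new_ear s r k k' : detour s r -> k \in K -> k \notin cov -> k' \in K ->
  k' \notin cov -> k != k' -> e k s -> e (last s r) k' -> False.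
Proof.
move=> dr kK kcov k'K k'cov kk' ks rk'; have [pr ur rK rcov] := dr.
have [uX XL] := detour_extra dr k'K k'cov.
have p0 : part [::] by exists L; case/andP: earsL.
have sK := rK s (mem_head _ _).
have rK' : all (fun x => x \notin K) r.
  by apply/allP => x xr; apply: rK; rewrite inE xr orbT.
have eN : all ear [:: (k, s :: r, k')].
  by rewrite all_seq1 /ear /= kK k'K ks rcons_path pr rk' sK rK'.
have uX' : uniq (k :: rcons (s :: r) k').
  rewrite cons_uniq uX andbT mem_rcons in_cons (negPf kk') /=.
  by apply/negP => /rK; rewrite kK.
have XL' : {in k :: rcons (s :: r) k', forall x, x \notin cov}.
  by move=> x; rewrite inE => /predU1P[->|/XL].
have := part_swap p0 eN uX' XL'; rewrite /mids /= => H.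
suff: false by []. by apply: H => x; rewrite cats0 elsE.
Qed.

Hypothesis W6 : #|~: K| <= 6.

Lemma part_size L0 s r : part L0 -> detour s r -> size (mids L0) + size (s :: r) <= #|~: K|.
Proof.
move=> pL dr; have [u0 K0] := detour_uniq pL dr.
rewrite -size_cat -(card_uniqP u0); apply: subset_leq_card.
by apply/subsetP => x /K0; rewrite inE.
Qed.

Lemma ear_part_size a p b s r : part [:: (a, p, b)] -> detour s r ->
  size p + size (s :: r) <= #|~: K|.
Proof. by move=> pL /(part_size pL); rewrite /mids /= cats0. Qed.

Lemma free_end_net a p b y s r c : part [:: (a, p, b)] -> y \in p ->
  detour s r -> e y s -> c \in K -> c \notin cov -> e (last s r) c ->
  exists a1 b1 c1 a2 b2 c2 a3 b3 c3, net a1 b1 c1 a2 b2 c2 a3 b3 c3.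
Proof.
move=> pL yp dr ys cK' ccov rc; move: yp pL => /splitPr[u v] pL.
have [rv ru] := free_end pL dr ys cK' ccov rc.
have := leq_trans (ear_part_size pL dr) W6; rewrite size_cat /= => sz.
(* Both sides of [y] are longer than the detour, which has at least one vertex; with six outer
   vertices only 2 + 1 + 2 + 1 is possible. *)
have [u2 v2 r0] : [/\ size u = 2, size v = 2 & size r = 0].
  by move: sz rv ru => /=; move: (size u) (size v) (size r) => i j k ijk ki kj; clear -ijk ki kj; split; lia.
case: u u2 pL {sz ru} => [|p1 [|p2 [|//]]] // _ pL.
case: v v2 pL {rv} => [|p3 [|p4 [|//]]] // _ pL.
move/size0nil: r0 => r0; rewrite {r}r0 /= in dr rc.
(* The triangle is p2, p3, y, where p2 and p3 are adjacent by [no_insertion]; its corners continue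
   to p1, p4, s and on to the clique vertices a, b, c. *)
exists a, p2, p1, b, p3, p4, c, y, s.
have [pr ur rK rcov] := dr; have s_in : s \in [:: s] by rewrite mem_head.
have [_ _ /= p23] := no_insertion pL (rK s s_in) (rcov s s_in) ys.
have := part_ears pL; rewrite /ears all_seq1 ear_catE /= => /andP[].
rewrite !andbT cats0 elsE => /and5P[aK bK /andP[ap1 p12] p2y /and3P[/and3P[yp3 p34 p4b] pK yvK]] uE.
have [uM KM] := detour_uniq pL dr; rewrite /mids /= in uM KM.
have pM : perm_eq [:: p2; p1; p3; p4; y; s] [:: p1; p2; y; p3; p4; s].
  by apply/permP => x /=; goal_lia.
split=> //.
- split; first by rewrite (perm_uniq pM).
  have sub : [set x in [:: p2; p1; p3; p4; y; s]] \subset ~: K.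
    by apply/subsetP => x; rewrite inE (perm_mem pM) => /KM; rewrite inE.
  have /eqP : [set x in [:: p2; p1; p3; p4; y; s]] == ~: K.
    have uM' : uniq [:: p2; p1; p3; p4; y; s] by rewrite (perm_uniq pM).
    rewrite eqEcard sub /= (leq_trans W6) //.
    rewrite -[6]/(size [:: p2; p1; p3; p4; y; s]) -(card_uniqP uM').
    by apply: subset_leq_card; apply/subsetP => x; rewrite inE.
  by move=> <- x; rewrite inE.
- have cE : c \notin els (a, [:: p1; p2; y; p3; p4], b).
    apply: contra ccov; case: pL => L1 [_ _ perm _].
    by rewrite (perm_mem perm) mem_cat /= cats0 => ->.
  move: cE; rewrite elsE /= aK bK cK' !inE !negb_or.
  move=> /andP[ca /and5P[_ _ _ _ /andP[_ cb]]].
  have ab : a != b by move: uE => /andP[]; rewrite !inE !negb_or => /and5P[_ _ _ _ /andP[]].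
  by rewrite (eq_sym a c) (eq_sym b c) ca cb ab.
- by split=> //; rewrite sym_e.
- by split=> //; rewrite sym_e.
- by split=> //; rewrite sym_e.
Qed.

(** The three vertices of the gap, [y], [y'] and the detour already make six, so the ear starts with
    [y] and the detour is [s] alone. Here the assumption on six outer vertices enters: [s] has a
    neighbour in [K], not the end of an ear by [used_end], and [free_end] would require vertices in
    front of [y]. *)
Lemma same_ear_false a u y v y' w b s r :
  (#|~: K| = 6 -> forall w, w \notin K -> exists2 k, k \in K & e w k) ->
  part [:: (a, u ++ y :: v ++ y' :: w, b)] ->
  detour s r -> e y s -> e (last s r) y' -> False.
Proof.
move=> attached pL dr ys ry'; have v3 := same_ear pL dr ys ry'.
have sz := ear_part_size pL dr; have sz6 := leq_trans sz W6.
have [u0 r0 sz5] : [/\ size u = 0, size r = 0 & 5 < #|~: K|].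
  move: sz sz6 v3; rewrite size_cat /= size_cat /=.
  move: (size u) (size v) (size r) (size w) #|~: K| => i j k l m sz sz6 v3.
  by clear -sz sz6 v3; split; lia.
have W_eq6 : #|~: K| = 6 by apply/eqP; rewrite eqn_leq W6.
move/size0nil: r0 => r0; rewrite {r}r0 in dr ry' sz sz6.
have [_ _ rK rcov] := dr; have s_in : s \in [:: s] by rewrite mem_head.
have sK := rK s s_in; have scov := rcov s s_in.
have [k kK sk] := attached W_eq6 s sK.
have kcov : k \notin cov.
  by apply/negP => kcov; apply: (used_end kK kcov sK scov); rewrite sym_e.
by have [] := free_end pL dr ys kK kcov sk; rewrite u0.
Qed.

Lemma maximal_uncovered z : z \notin K -> z \notin mids L ->
  (#|~: K| = 6 -> forall w, w \notin K -> exists2 k, k \in K & e w k) ->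
  exists a1 b1 c1 a2 b2 c2 a3 b3 c3, net a1 b1 c1 a2 b2 c2 a3 b3 c3.
Proof.
move=> zK zL attached.
have mid_cov x : x \notin K -> x \in cov -> exists2 E, E \in L & x \in E.1.2.
  move=> xK /flattenP[_ /mapP[E EL ->]]; rewrite elsE inE mem_rcons inE.
  have /and5P[EK1 EK2 _ _ _] : ear E by case/andP: earsL => /allP/(_ E EL).
  case/or3P => [/eqP xE|/eqP xE|xE]; last by exists E.
    by rewrite xE EK1 in xK.
  by rewrite xE EK2 in xK.
pose U := [set x | (x \notin K) && (x \notin cov)].
have zU : z \in U.
  rewrite inE zK /=; apply: contra zL => /(mid_cov z zK)[E EL zE].
  by apply/flattenP; exists E.1.2 => //; apply: map_f.
pose rl : rel T := fun x y => [&& e x y, x \in U & y \in U].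
have sym_rl : symmetric rl by move=> x y; rewrite /rl sym_e [(x \in U) && _]andbC.
(* The component of [z] among the uncovered outer vertices: any two of its vertices are joined by a
   detour, and its edges leave only to [K] or to covered vertices. *)
pose Rz := [set x | connect rl z x].
have RU x : x \in Rz -> x \in U.
  rewrite inE => /connectP[p pz ->]; elim/last_ind: p pz => [//|p t _].
  by rewrite rcons_path last_rcons => /andP[_ /and3P[]].
have Rclosed x y : x \in Rz -> y \notin Rz -> e x y -> y \notin U.
  move=> xR yR xy; apply: contra yR => yU; move: (xR); rewrite !inE => zx.
  by apply: connect_trans zx (connect1 _); rewrite /rl xy yU RU.
have R0 : Rz != set0 by apply/set0Pn; exists z; rewrite inE connect0.
have Rc : 1 < #|~: Rz|.
  apply: leq_trans (ltnW K_ge3) _; apply: subset_leq_card; apply/subsetP => x xK.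
  by rewrite inE; apply/negP => /RU; rewrite inE xK.
have [x [y [x' [y' [xR yR x'R y'R [xy xy' yy']]]]]] := two_attachments conn_e R0 Rc.
have [r [dr lr]] : exists r, detour x r /\ last x r = x'.
  have : connect rl x x'.
    move: xR x'R; rewrite !inE => zx; apply: connect_trans.
    by rewrite (sym_connect_sym sym_rl).
  case/connectP => p px ->; case/shortenP: px => r px ur _; exists r; split=> //.
  have pathU q : forall a, a \in U -> path rl a q -> {in a :: q, forall t, t \in U}.
    elim: q => [|c q IH] a aU /=; first by move=> _ t; rewrite inE => /eqP ->.
    move=> /andP[/and3P[_ _ cU] cq] t; rewrite inE => /predU1P[-> //|].
    exact: IH.
  have rU := pathU r x (RU x xR) px.
  split=> //; last 2 first.
  - by move=> t /rU; rewrite inE => /andP[].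
  - by move=> t /rU; rewrite inE => /andP[].
  by apply: sub_path px => s t /and3P[].
have xU := RU x xR; have x'U := RU x' x'R.
have place t s : s \in U -> t \notin U -> e s t ->
    (t \in K /\ t \notin cov) \/ (exists2 E, E \in L & t \in E.1.2).
  rewrite !inE => /andP[sK scov] tU st; case: (boolP (t \in K)) tU => tK /=.
    by move=> _; left; split=> //; apply/negP => tcov; apply: (used_end tK tcov sK scov); rewrite sym_e.
  by rewrite negbK => tcov; right; apply: mid_cov.
have drr := detour_rev dr; rewrite lr in drr.
have lrr : last x' (rev (belast x r)) = x by rewrite -lr last_rev_belast.
have yx : e y x by rewrite sym_e.
have y'x' : e y' x' by rewrite sym_e.
case: (place y x xU (Rclosed x y xR yR xy) xy) => [[yK ycov]|[E EL yE]];
  case: (place y' x' x'U (Rclosed x' y' x'R y'R xy') xy') => [[y'K y'cov]|[E' E'L y'E']].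
- by case: (no_new_ear dr yK ycov y'K y'cov yy' yx); rewrite lr.
- have := part1 E'L; case: E' E'L y'E' => [[a p] b] /= E'L y'p pL.
  by apply: (free_end_net pL y'p drr y'x' yK ycov); rewrite lrr.
- have := part1 EL; case: E EL yE => [[a p] b] /= EL yp pL.
  by apply: (free_end_net pL yp dr yx y'K y'cov); rewrite lr.
exfalso; have [EE'|EE'] := eqVneq E E'.
  have := part1 EL; rewrite -EE' in y'E'; case: E EL yE y'E' {EE'} => [[a p] b] /= EL yp y'p pL.
  move: yp pL y'p => /splitPr[u v] pL; rewrite mem_cat inE eq_sym (negPf yy') /=.
  case/orP => y'u.
    case/splitPr: y'u pL => u1 v1; rewrite -catA /= => pL.
    by apply: (same_ear_false attached pL drr y'x'); rewrite lrr.
  case/splitPr: y'u pL => u1 v1 pL.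
  by apply: (same_ear_false attached pL dr yx); rewrite lr.
have := part2 EL E'L EE'.
case: E EL yE {EE'} => [[a p] b] /= EL yp; case: E' E'L y'E' => [[c q] d] /= E'L y'q pL.
have p2 := ear_size (@part_catl [:: _] [:: _] pL).
have q2 := ear_size (@part_catr [:: (a, p, b)] [:: _] pL).
have := leq_trans (part_size pL dr) W6; rewrite /mids /= cats0 size_cat /= => sz.
(* Two ears with at least two interior vertices each and a nonempty detour fit into six vertices
   only if one ear has exactly two and the other at most three. *)
case: (leqP (size p) 2) => p2'.
  have pE2 : size p = 2 by apply/eqP; rewrite eqn_leq p2' p2.
  move: y'q q2 sz pL => /splitPr[u v] q2 sz pL.
  apply: (merge_ears pL yp pE2 _ dr yx); last by rewrite lr.
  move: sz; rewrite size_cat /= pE2; move: (size u) (size v) (size r) => i j k h.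
  by clear -h; lia.
have qE2 : size q = 2 by move: sz p2' q2; move: (size p) (size q) (size r) => i j k h1 h2 h3; clear -h1 h2 h3; lia.
move: yp p2 p2' sz pL => /splitPr[u v] _ _ sz /(part_perm (permEl (perm_catC [:: _] [:: _]))) pL.
apply: (merge_ears pL y'q qE2 _ drr y'x'); last by rewrite lrr.
move: sz; rewrite size_cat /= qE2; move: (size u) (size v) (size r) => i j k h.
by clear -h; lia.
Qed.


End MaximalSystem.

Lemma exists_maximal_ears : exists2 L, ears L &
  forall M, ears M -> size (mids M) <= size (mids L).
Proof.
pose P m := `[< exists2 L, ears L & size (mids L) = m >].
have P0 : exists m, P m by exists 0; apply/asboolP; exists [::].
have Pub m : P m -> m <= #|T|.
  by case/asboolP => L /mids_uniq[/card_uniqP <- _] <-; apply: max_card.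
case: (ex_maxnP P0 Pub) => m /asboolP[L eL <-] maxL; exists L => // M eM.
by apply: maxL; apply/asboolP; exists M.
Qed.

Lemma hamiltonian_or_net : #|~: K| <= 6 ->
  (#|~: K| = 6 -> forall w, w \notin K -> exists2 k, k \in K & e w k) ->
  hamiltonian_rel e \/
  exists a1 b1 c1 a2 b2 c2 a3 b3 c3, net a1 b1 c1 a2 b2 c2 a3 b3 c3.
Proof.
move=> W6 attached; have [L earsL maxL] := exists_maximal_ears.
have [covL|] := pselect (forall w, w \notin K -> w \in mids L).
  by left; apply: ear_hamiltonian covL.
move=> /existsNP[z /not_implyP[zK zL]]; right.
by apply: (maximal_uncovered earsL maxL W6 zK) => //; apply/negP.
Qed.

(** * Rigidity of the net in a non-Hamiltonian graph *)

Lemma net_swap a1 b1 c1 a2 b2 c2 a3 b3 c3 :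
  net a1 b1 c1 a2 b2 c2 a3 b3 c3 -> net a2 b2 c2 a1 b1 c1 a3 b3 c3.
Proof.
case=> -[uW Wb] [ua aK] [ac1 ac2 ac3] [cb1 cb2 cb3] [b12 b13 b23].
have p : perm_eq [:: b2; c2; b1; c1; b3; c3] [:: b1; c1; b2; c2; b3; c3].
  by apply/permP => x /=; goal_lia.
have pa : perm_eq [:: a2; a1; a3] [:: a1; a2; a3] by apply/permP => x /=; goal_lia.
split=> //; last by rewrite sym_e.
- by split=> [|x]; rewrite ?(perm_uniq p) // Wb (perm_mem p).
- by rewrite (perm_uniq pa) (perm_all _ pa).
Qed.

Lemma net_rot a1 b1 c1 a2 b2 c2 a3 b3 c3 :
  net a1 b1 c1 a2 b2 c2 a3 b3 c3 -> net a2 b2 c2 a3 b3 c3 a1 b1 c1.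
Proof.
case=> -[uW Wb] [ua aK] [ac1 ac2 ac3] [cb1 cb2 cb3] [b12 b13 b23].
have p : perm_eq [:: b2; c2; b3; c3; b1; c1] [:: b1; c1; b2; c2; b3; c3].
  by apply/permP => x /=; goal_lia.
have pa : perm_eq [:: a2; a3; a1] [:: a1; a2; a3] by apply/permP => x /=; goal_lia.
split=> //; last by split; rewrite // sym_e.
- by split=> [|x]; rewrite ?(perm_uniq p) // Wb (perm_mem p).
- by rewrite (perm_uniq pa) (perm_all _ pa).
Qed.

Section Net.
Hypothesis not_ham : ~ hamiltonian_rel e.

Lemma net_no_ears a1 b1 c1 a2 b2 c2 a3 b3 c3 L : net a1 b1 c1 a2 b2 c2 a3 b3 c3 ->
  all ear L -> uniq (mids L) ->
  perm_eq (mids L) [:: b1; c1; b2; c2; b3; c3] ->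
  uniq ([seq E.1.1 | E <- L] ++ [seq E.2 | E <- L]) -> False.
Proof.
case=> -[uW Wb] _ _ _ _ eL uL pL uends; apply: not_ham.
apply: (@ear_hamiltonian L); last first.
  by move=> w wK; rewrite (perm_mem pL) -Wb inE.
rewrite /ears eL /=.
apply: (@count_le_uniq _ _ (mids L ++ [seq E.1.1 | E <- L] ++ [seq E.2 | E <- L])).
  move=> x; rewrite /mids; elim: (L) => //= E M; rewrite !count_cat /= !count_cat count_els /=.
  by count_lia.
rewrite cat_uniq uL uends andbT; apply/hasPn => x; rewrite mem_cat => xE.
apply/negP; rewrite (perm_mem pL) -Wb inE => /negP; apply.
by case/orP: xE => /mapP[E EL ->]; have /and5P[] := allP eL E EL.
Qed.

(** Either edge would complete an ear from [a2] to [a3], in one direction or the other, through all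
    six outer vertices. *)
Lemma net_nonadjacent a1 b1 c1 a2 b2 c2 a3 b3 c3 :
  net a1 b1 c1 a2 b2 c2 a3 b3 c3 -> ~~ e c1 b2 /\ ~~ e c1 c2.
Proof.
move=> N; have noL := net_no_ears N; case: N.
case=> uW Wb [/and3P[ua1 ua2 _] /and4P[a1K a2K a3K _]] [ac1 ac2 ac3] [cb1 cb2 cb3] [b12 b13 b23].
have WK x : x \in [:: b1; c1; b2; c2; b3; c3] -> x \notin K by rewrite -Wb inE.
have [b1K c1K b2K [c2K b3K c3K]] : [/\ b1 \notin K, c1 \notin K, b2 \notin K &
    [/\ c2 \notin K, b3 \notin K & c3 \notin K]].
  by do !split; apply: WK; rewrite !inE eqxx ?orbT.
have a23 : a2 != a3 by move: ua2; rewrite inE.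
split; apply/negP => h.
  have p : perm_eq [:: c2; b2; c1; b1; b3; c3] [:: b1; c1; b2; c2; b3; c3].
    by apply/permP => x /=; goal_lia.
  apply: (noL [:: (a2, [:: c2; b2; c1; b1; b3; c3], a3)]) => //.
  - by rewrite all_seq1 /ear /= a2K a3K ac2 cb2 sym_e h cb1 b13 sym_e cb3 sym_e ac3
      c2K b2K c1K b1K b3K c3K.
  - by rewrite /mids /= -/(uniq [:: c2; b2; c1; b1; b3; c3]) (perm_uniq p).
  - by rewrite /= inE a23.
have p : perm_eq [:: c3; b3; b2; b1; c1; c2] [:: b1; c1; b2; c2; b3; c3].
  by apply/permP => x /=; goal_lia.
apply: (noL [:: (a3, [:: c3; b3; b2; b1; c1; c2], a2)]) => //.
- by rewrite all_seq1 /ear /= a2K a3K ac3 cb3 sym_e b23 sym_e b12 sym_e cb1 h sym_e ac2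
      c2K b2K c1K b1K b3K c3K.
- by rewrite /mids /= -/(uniq [:: c3; b3; b2; b1; c1; c2]) (perm_uniq p).
- by rewrite /= inE eq_sym a23.
Qed.

(** A neighbour [k] other than [a1] also differs from [a2] and [a3], for otherwise [b1] and [c2] or
    [c3] are outer neighbours of one clique vertex, hence adjacent. Then an ear from [a1] to [k]
    through [c1] and [b1], and one from [a2] to [a3], cover all outer vertices. *)
Lemma net_K_nbr a1 b1 c1 a2 b2 c2 a3 b3 c3 k :
  net a1 b1 c1 a2 b2 c2 a3 b3 c3 -> k \in K -> e b1 k -> k = a1.
Proof.
move=> N kK bk; have noL := net_no_ears N.
have [n12 _] := net_nonadjacent N; have [n21 _] := net_nonadjacent (net_swap N).
have [n31 _] := net_nonadjacent (net_rot (net_rot N)).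
case: N => -[uW Wb] [/and3P[ua1 ua2 _] /and4P[a1K a2K a3K _]] [ac1 ac2 ac3] [cb1 cb2 cb3] [b12 b13 b23].
have WK x : x \in [:: b1; c1; b2; c2; b3; c3] -> x \notin K by rewrite -Wb inE.
have [b1K c1K b2K [c2K b3K c3K]] : [/\ b1 \notin K, c1 \notin K, b2 \notin K &
    [/\ c2 \notin K, b3 \notin K & c3 \notin K]].
  by do !split; apply: WK; rewrite !inE eqxx ?orbT.
have [c1b2 b1c2 b1c3] : [/\ c1 != b2, b1 != c2 & b1 != c3].
  case/and3P: uW; rewrite !inE !negb_or => /and5P[_ _ b1c2 _ b1c3] /and4P[c1b2 _ _ _] _.
  by [].
apply/eqP; apply: contraT => ka1.
have nkc1 : ~~ e c1 k.
  apply: contraNN ka1 => ck; apply/eqP.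
  by apply: (K_nbr_uniq c1K); rewrite // sym_e.
have b1c1 : e b1 c1 by rewrite sym_e.
have kb2 : e k b2.
  have := claw_e b1c1 bk b12; rewrite (negPf n12) (negPf nkc1) /=; apply=> //.
    by apply: contraNneq c1K => ->.
  by apply: contraNneq b2K => <-.
have kb3 : e k b3 by apply: (diamond_e bk b12 b13); rewrite // -?sym_e //; apply: contraNneq b3K => <-.
have ka2 : k != a2.
  apply: contraNneq n21 => ka2; rewrite sym_e.
  by apply: (K_attached_clique kK); rewrite // ?ka2 // sym_e -ka2.
have ka3 : k != a3.
  apply: contraNneq n31 => ka3; rewrite sym_e.
  by apply: (K_attached_clique kK); rewrite // ?ka3 // sym_e -ka3.
have p : perm_eq [:: c1; b1; c2; b2; b3; c3] [:: b1; c1; b2; c2; b3; c3].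
  by apply/permP => x /=; goal_lia.
exfalso; apply: (noL [:: (a1, [:: c1; b1], k); (a2, [:: c2; b2; b3; c3], a3)]) => //.
- by rewrite /= andbT /ear /= a1K kK ac1 cb1 bk a2K a3K ac2 cb2 b23 sym_e cb3 sym_e ac3
   c1K b1K c2K b2K b3K c3K.
- by rewrite /mids /= -/(uniq [:: c1; b1; c2; b2; b3; c3]) (perm_uniq p).
- move: ua1 ua2; rewrite /= !inE !negb_or => /andP[-> ->] ->.
  by rewrite ![_ == k]eq_sym ka1 ka2 ka3.
Qed.

End Net.
End Ears.

(** * The signless Laplacian spectral radius *)

Section Spectral.
Local Open Scope ring_scope.
Local Open Scope sesquilinear_scope.

(** Over the complex numbers the matrix is Hermitian and is diagonalised by a unitary [P]. In the
    coordinates [w] both forms are sums of |w_i|^2, the left one weighted by eigenvalues. *)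
Lemma rayleigh (R : rcfType) n (A : 'M[R]_n) (q : R) : A^T = A ->
  (forall x, eigenvalue A x -> x <= q) ->
  forall v : 'rV_n, (v *m A *m v^T) 0 0 <= q * (v *m v^T) 0 0.
Proof.
move=> symA leq v; pose toC := real_complex R.
pose B := map_mx toC A; pose w0 := map_mx toC v.
have realC m k (M : 'M[R]_(m, k)) : map_mx toC M \is a realmx.
  by apply/mxOverP => i j; rewrite mxE complex_real.
have hB : B \is hermsymmx.
  apply: realsym_hermsym (realC _ _ _); apply/is_hermitianmxP.
  by rewrite expr0 scale1r map_mx_id // /B map_trmx symA.
have := hermitian_spectral_diag_real hB.
have /orthomx_spectralP := hermitian_normalmx hB.
have uP := spectral_unitarymx B.
set P := spectralmx B in uP *; set d := spectral_diag B => sP dreal.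
(* The rows of [P] are left eigenvectors, so each diagonal entry, being real, is an eigenvalue of
   [A] itself. *)
have led i : d 0 i <= toC q.
  have /complex_realP [r dr] := mxOverP dreal 0 i.
  rewrite dr lecR; apply: leq; rewrite -(eigenvalue_map toC) -/B.
  have PB : P *m B = diag_mx d *m P.
    by rewrite {1}sP -!mulmxA mulKVmx ?unitarymx_unit.
  apply/eigenvalueP; exists (row i P).
    by rewrite -row_mul PB row_mul row_diag_mx -scalemxAl -rowE dr.
  have : row_free P by rewrite row_free_unit unitarymx_unit.
  apply: contraTneq => r0; apply/negP => /row_freeP [Q PQ].
  have /rowP/(_ i) : row i (1%:M : 'M[R[i]]_n) = 0.
    by rewrite -PQ row_mul r0 mul0mx.
  by rewrite !mxE eqxx => /eqP; rewrite oner_eq0.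
pose w := w0 *m invmx P.
have conjw0 : w0 ^t* = map_mx toC v^T.
  apply/matrixP => i j; rewrite !mxE; apply: conj_Creal.
  by rewrite complex_real.
have wt : w ^t* = P *m w0 ^t*.
  rewrite /w trmx_mul map_mxM invmx_unitary //; congr (_ *m _).
  by rewrite trmxCK.
have qfB : toC ((v *m A *m v^T) 0 0) = \sum_i d 0 i * `|w 0 i| ^+ 2.
  transitivity ((map_mx toC (v *m A *m v^T)) 0 0); first by rewrite [RHS]mxE.
  rewrite !map_mxM -conjw0 -/B -/w0 sP !mulmxA -/w -mulmxA -wt mul_mx_diag mxE.
  apply: eq_bigr => i _; rewrite !mxE normCK; ring.
have qf1 : toC ((v *m v^T) 0 0) = \sum_i `|w 0 i| ^+ 2.
  transitivity ((map_mx toC (v *m v^T)) 0 0); first by rewrite [RHS]mxE.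
  have -> : map_mx toC (v *m v^T) = w *m w ^t*.
    by rewrite wt /w -!mulmxA mulKmx ?unitarymx_unit // map_mxM conjw0.
  by rewrite mxE; apply: eq_bigr => i _; rewrite !mxE normCK.
rewrite -lecR rmorphM /= -/toC qfB qf1 mulr_sumr.
apply: ler_sum => i _; rewrite ler_wpM2r ?exprn_ge0 //.
Qed.

(** * The signless Laplacian on functions of the vertices *)

Section QuadraticForm.
Variables (R : realType) (G : sgraph).
Implicit Types (x y z : G -> R) (u v : G).

Definition qop x u : R := (degree u)%:R * x u + \sum_(v | adj u v) x v.
Definition qform x : R := \sum_u x u * qop x u.

Lemma natr_degree u : (degree u)%:R = \sum_(v | adj u v) 1 :> R.
Proof. by rewrite sumr_const; congr (_%:R); apply: eq_card => v; rewrite inE. Qed.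

Lemma qopE x u : qop x u = \sum_(v | adj u v) (x u + x v).
Proof.
rewrite big_split /qop natr_degree mulr_suml; congr (_ + _).
by apply: eq_bigr => v _; rewrite mul1r.
Qed.

Lemma mul_qop_sym x z : \sum_u z u * qop x u = \sum_u x u * qop z u.
Proof.
rewrite /qop; under eq_bigr do rewrite mulrDr mulr_sumr.
under [RHS]eq_bigr do rewrite mulrDr mulr_sumr.
rewrite !big_split /=; congr (_ + _); first by apply: eq_bigr => u _; ring.
rewrite [RHS](exchange_big_dep xpredT) //=; apply: eq_bigr => u _.
under eq_bigl do rewrite adj_sym.
by apply: eq_bigr => v _; ring.
Qed.

(** The double sum runs over ordered pairs and so meets every edge twice. *)
Lemma qform_edges x :
  qform x *+ 2 = \sum_u \sum_(v | adj u v) (x u + x v) ^+ 2.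
Proof.
rewrite /qform; under eq_bigr do rewrite qopE mulr_sumr.
have -> : forall t : R, t *+ 2 = t + t by move=> t; rewrite mulr2n.
rewrite {2}(exchange_big_dep xpredT) //= -big_split /=; apply: eq_bigr => u _.
under [X in _ + X]eq_bigl do rewrite adj_sym.
by rewrite -big_split /=; apply: eq_bigr => v _; ring.
Qed.

Lemma mul_row_signless x i :
  ((\row_j x (enum_val j)) *m signless_laplacian R G) 0 i = qop x (enum_val i).
Proof.
rewrite mulmxDr mxE mul_mx_diag !mxE mulrC; congr (_ + _).
rewrite [RHS](reindex (@enum_val G G)) /=; last first.
  by apply: onW_bij; exact: enum_val_bij.
rewrite [RHS]big_mkcond /=; apply: eq_bigr => j _; rewrite !mxE adj_sym.
by case: adj; rewrite ?mulr1 ?mulr0.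
Qed.

Lemma q_eigenfun : (0 < #|G|)%N ->
  exists2 y : G -> R, (exists u, y u != 0) & forall u, qop y u = q R G * y u.
Proof.
move=> /(q_largest R)[/eigenvalueP[v vQ v0] _].
pose y u := v 0 (enum_rank u).
have vy : v = \row_j y (enum_val j).
  by apply/rowP => j; rewrite mxE /y enum_valK.
exists y => [|u].
  case/rV0Pn: v0 => i vi; exists (enum_val i).
  by rewrite /y enum_valK.
move/rowP: vQ => /(_ (enum_rank u)).
by rewrite {1}vy mul_row_signless mxE enum_rankK.
Qed.

(** The Collatz-Wielandt bound: at a vertex [u] that maximises |y| / x for an eigenfunction [y] of
    q, the eigenvalue equation is dominated by that of [x]. *)
Lemma q_le_test x l : (0 < #|G|)%N -> (forall u, 0 < x u) ->
  (forall u, qop x u <= l * x u) -> q R G <= l.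
Proof.
move=> G0 x0 xl; have [y [u0 yu0] yq] := q_eigenfun G0.
have [u _ umax] : {u | true & forall v, `|y v| / x v <= `|y u| / x u}.
  by case: (@Order.TotalTheory.arg_maxP _ _ _ u0 xpredT (fun v => `|y v| / x v)) => // u _ H;
    exists u => // v; apply: H.
set M := `|y u| / x u in umax.
have leM v : `|y v| <= M * x v by rewrite -ler_pdivrMr //; exact: umax.
have yu : `|y u| = M * x u by rewrite /M divfK // gt_eqF.
have M0 : 0 < M.
  have : 0 < `|y u0| by rewrite normr_gt0.
  by move=> /lt_le_trans/(_ (leM u0)); rewrite pmulr_lgt0.
rewrite -(ler_pM2r (mulr_gt0 M0 (x0 u))) -yu.
apply: (@le_trans _ _ `|q R G * y u|).
  by rewrite normrM ler_wpM2r // ler_norm.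
rewrite -yq yu mulrCA.
apply: (@le_trans _ _ (M * qop x u)); last by rewrite ler_wpM2l // ltW.
rewrite !qopE mulr_sumr; apply: le_trans (ler_norm_sum _ _ _) _.
apply: ler_sum => v _; rewrite mulrDr; apply: le_trans (ler_normD _ _) _.
by rewrite lerD.
Qed.

Lemma q_rayleigh x : (0 < #|G|)%N -> qform x <= q R G * \sum_u x u ^+ 2.
Proof.
move=> /(q_largest R)[_ /(rayleigh (signless_laplacian_sym R G))].
move=> /(_ (\row_j x (enum_val j))).
have enb : {on [pred _ : G | true], bijective (@enum_val G G)}.
  by apply: onW_bij; exact: enum_val_bij.
congr (_ <= _ * _); rewrite mxE /qform [RHS](reindex _ enb) /=.
  by apply: eq_bigr => i _; rewrite mul_row_signless !mxE mulrC.
by apply: eq_bigr => i _; rewrite !mxE expr2.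
Qed.

Lemma qopD x z t u : qop (fun v => x v + t * z v) u = qop x u + t * qop z u.
Proof. by rewrite /qop big_split -mulr_sumr /=; ring. Qed.

(** A maximiser of the Rayleigh quotient is an eigenfunction: moving from [x] along its residual [z]
    changes the quotient to first order by the squared norm [s] of [z], so [s] vanishes. *)
Lemma q_rayleigh_eq x : (0 < #|G|)%N -> q R G * \sum_u x u ^+ 2 <= qform x ->
  forall u, qop x u = q R G * x u.
Proof.
move=> G0 xq.
pose z u := qop x u - q R G * x u.
pose c := q R G * \sum_u z u ^+ 2 - qform z.
pose s := \sum_u z u ^+ 2.
have s0 : 0 <= s by apply: sumr_ge0 => u _; apply: sqr_ge0.
have c0 : 0 <= c by rewrite subr_ge0 q_rayleigh.
have key t : 0 <= t ^+ 2 * c - 2 * t * s.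
  have := q_rayleigh (fun v => x v + t * z v) G0.
  have -> : \sum_u (x u + t * z u) ^+ 2 =
      \sum_u x u ^+ 2 + (2 * t) * \sum_u z u * x u + t ^+ 2 * s.
    by rewrite /s !mulr_sumr -!big_split /=; apply: eq_bigr => u _; ring.
  have -> : qform (fun v => x v + t * z v) =
      qform x + (2 * t) * \sum_u z u * qop x u + t ^+ 2 * qform z.
    transitivity (qform x + t * (\sum_u z u * qop x u) +
        t * (\sum_u x u * qop z u) + t ^+ 2 * qform z).
      rewrite /qform !mulr_sumr -!big_split /=; apply: eq_bigr => u _.
      by rewrite qopD; ring.
    by rewrite -mul_qop_sym; ring.
  have sE : s = \sum_u z u * qop x u - q R G * \sum_u z u * x u.
    by rewrite /s mulr_sumr -sumrB; apply: eq_bigr => u _; rewrite /z; ring.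
  have : 2 * t * s = 2 * t * (\sum_u z u * qop x u - q R G * \sum_u z u * x u).
    by rewrite sE.
  by move: xq; rewrite /c -/s; lra.
have : s <= 0.
  have c1 : 0 < c + 1 by lra.
  have tc : (c + 1)^-1 * (c + 1) = 1 by rewrite mulVf // gt_eqF.
  have t0 : 0 < (c + 1)^-1 by rewrite invr_gt0.
  (* At t = s/(c + 1) the quadratic in [key] is negative for positive [s], as c/(c + 1) < 2; the
     summand 1 takes care of c = 0. *)
  rewrite leNgt; apply/negP => sgt; have := key ((c + 1)^-1 * s).
  rewrite leNgt => /negP; apply.
  move: tc t0; set t := _^-1 => tc t0.
  have -> : (t * s) ^+ 2 * c - 2 * (t * s) * s = - (t * s ^+ 2 * (2 - t * c)) by ring.
  by rewrite oppr_lt0 !mulr_gt0 ?exprn_gt0 //; lra.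
move=> sle u; apply/eqP; rewrite -subr_eq0 -/(z u) -sqrf_eq0; apply/eqP.
apply: (@psumr_eq0P _ _ xpredT (fun u => z u ^+ 2)) => //.
  by move=> v _; apply: sqr_ge0.
by apply: le_anti; rewrite -/s sle s0.
Qed.

End QuadraticForm.

Definition edge_cut_nonempty (T : finType) (e : rel T) : Prop :=
  forall S : {set T}, S != set0 -> ~: S != set0 ->
  exists x y, [/\ x \in S, y \notin S & e x y].

(** * Monotonicity of q under spanning subgraphs *)

Section Spanning.
Variables (R : realType) (G H : sgraph) (f : G -> H).
Hypotheses (bij_f : bijective f) (G_gt0 : (0 < #|G|)%N).
Hypothesis f_adj : forall u v, adj u v -> adj (f u) (f v).

(** The transported [y] is a test function for [H], and the double sum is the contribution of the
    edges of [H] that are missing in [G]. *)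
Lemma q_spanning_defect (y : G -> R) :
  qform y *+ 2 + \sum_u \sum_(v | adj (f u) (f v) && ~~ adj u v) (y u + y v) ^+ 2
  <= (q R H * \sum_u y u ^+ 2) *+ 2.
Proof.
have [g fK gK] := bij_f.
have H0 : (0 < #|H|)%N by rewrite -(bij_eq_card bij_f).
have := q_rayleigh (fun w => y (g w)) H0.
have onf (P : {pred H}) : {on P, bijective f} by apply: onW_bij.
rewrite (reindex f (onf _)) /=; under eq_bigr do rewrite fK.
rewrite -(@ler_pMn2r _ 2) // => le; apply: le_trans le.
rewrite !qform_edges (reindex f (onf _)) /= -big_split /=.
apply: ler_sum => u _; rewrite fK [leRHS](reindex f (onf _)) /=.
rewrite [leRHS](bigID (fun v => adj u v)) /=.
rewrite lerD //; last by under [leRHS]eq_bigr do rewrite fK.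
rewrite le_eqVlt; apply/orP; left; apply/eqP; apply: eq_big => [v|v _]; last by rewrite fK.
by case: (boolP (adj u v)) => [/f_adj ->|]; rewrite ?andbF.
Qed.

Lemma qform_norm (y : G -> R) : qform y <= qform (fun u => `|y u|).
Proof.
rewrite -(@ler_pMn2r _ 2) // !qform_edges.
apply: ler_sum => u _; apply: ler_sum => v _.
rewrite -[leLHS](@real_normK) ?num_real // lerXn2r ?nnegrE ?addr_ge0 //.
exact: ler_normD.
Qed.

Lemma sum_sqr_norm (y : G -> R) : \sum_u `|y u| ^+ 2 = \sum_u y u ^+ 2.
Proof. by apply: eq_bigr => u _; rewrite real_normK ?num_real. Qed.

Lemma q_spanning_le : q R G <= q R H.
Proof.
have [y [u0 yu0] yq] := q_eigenfun R G_gt0.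
have y2 : 0 < \sum_u y u ^+ 2.
  rewrite (bigD1 u0) //= ltr_wpDr ?exprn_even_gt0 //.
  by apply: sumr_ge0 => u _; apply: sqr_ge0.
have qy : qform y = q R G * \sum_u y u ^+ 2.
  by rewrite /qform mulr_sumr; apply: eq_bigr => u _; rewrite yq; ring.
rewrite -(ler_pM2r y2) -qy -(@ler_pMn2r _ 2) //.
apply: le_trans (q_spanning_defect y); rewrite lerDl.
by apply: sumr_ge0 => u _; apply: sumr_ge0 => v _; apply: sqr_ge0.
Qed.

(** A Perron-Frobenius argument: |y| is again a maximiser, hence an eigenfunction, and a zero of it
    would spread to all neighbours. It is thus positive, and an edge of [H] missing in [G] would
    make q(H) strictly larger. *)
Lemma q_spanning_eq : edge_cut_nonempty (@adj G) -> q R H <= q R G ->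
  isomorphic G H.
Proof.
move=> conG qHG; have [y [u0 yu0] yq] := q_eigenfun R G_gt0.
pose z u := `|y u|.
have qz : q R G * \sum_u z u ^+ 2 <= qform z.
  rewrite sum_sqr_norm; apply: le_trans (qform_norm y).
  by rewrite /qform mulr_sumr; apply: ler_sum => u _; rewrite yq; rewrite le_eqVlt; apply/orP; left; apply/eqP; ring.
have zq := q_rayleigh_eq G_gt0 qz.
have z0 u : 0 < z u.
  rewrite lt_def normr_ge0 andbT; apply: contraT; rewrite negbK => zu.
  have [||v [w [vS wS vw]]] := conG [set v | z v == 0].
    by apply/set0Pn; exists u; rewrite inE.
    by apply/set0Pn; exists u0; rewrite !inE normr_eq0.
  rewrite inE in vS; case/negP: wS; rewrite inE.
  move: (zq v); rewrite /qop (eqP vS) !mulr0 add0r => sum0.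
  apply/eqP; apply: (psumr_eq0P _ sum0) => // t _; exact: normr_ge0.
exists f => // u v; apply/idP/idP; last exact: f_adj.
move=> fuv; apply: contraT => nuv.
have := q_spanning_defect z; rewrite leNgt => /negP[].
apply: (@le_lt_trans _ _ ((q R G * \sum_u z u ^+ 2) *+ 2)).
  rewrite lerMn2r /=; rewrite ler_wpM2r //.
  by apply: sumr_ge0 => t _; apply: sqr_ge0.
have qzz : q R G * (\sum_u z u ^+ 2) = qform z.
  by rewrite /qform mulr_sumr; apply: eq_bigr => t _; rewrite zq; ring.
rewrite qzz ltrDl (bigD1 u) //= (bigD1 v) ?fuv ?nuv //=.
rewrite -addrA ltr_pwDl ?exprn_gt0 ?addr_gt0 // addr_ge0 //.
  by apply: sumr_ge0 => t _; apply: sqr_ge0.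
by apply: sumr_ge0 => t _; apply: sumr_ge0 => t' _; apply: sqr_ge0.
Qed.
End Spanning.

(** * Bounds on q from test vectors *)

Section Bounds.
Variables (R : realType) (G : sgraph).

(** The Rayleigh quotient of the indicator of [S]. *)
Lemma q_set_ge (S : {set G}) : S != set0 ->
  (\sum_(u in S) (degree u + #|[set v in S | adj u v]|))%:R <= q R G * #|S|%:R.
Proof.
move=> /set0Pn[u0 u0S]; have G0 : (0 < #|G|)%N by apply/card_gt0P; exists u0.
pose x u : R := (u \in S)%:R.
have -> : #|S|%:R = \sum_u x u ^+ 2.
  rewrite -sum1_card natr_sum big_mkcond /=; apply: eq_bigr => u _.
  by rewrite /x; case: (u \in S); rewrite ?expr1n ?expr0n.
apply: le_trans (q_rayleigh x G0).
rewrite le_eqVlt; apply/orP; left; apply/eqP.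
rewrite /qform natr_sum big_mkcond /=; apply: eq_bigr => u _; rewrite {1}/x.
case: ifP => uS; last by rewrite mul0r.
rewrite mul1r /qop {1}/x uS mulr1 natrD; congr (_ + _).
rewrite -sum1dep_card natr_sum big_mkcondl /=.
by apply: eq_bigr => v _; rewrite /x; case: (v \in S).
Qed.

Lemma q_le_degree (l : R) : (0 < #|G|)%N -> (forall v : G, 0 < degree v)%N ->
  (forall v : G, (degree v ^ 2 + \sum_(u | adj v u) degree u)%:R <= l * (degree v)%:R) ->
  q R G <= l.
Proof.
move=> G0 d0 H; apply: (@q_le_test _ _ (fun v => (degree v)%:R)) => // v.
  by rewrite ltr0n.
by apply: le_trans (H v); rewrite natrD natr_sum natrX /qop expr2.
Qed.

Variables (K : {set G}) (N : nat).
Hypotheses (K_clique : {in K &, forall u v, u != v -> adj u v}).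
Hypotheses (cardK : #|K| = N) (cardCK : #|~: K| = 6%N) (N45 : (45 <= N)%N).
Hypothesis one_nbr : forall w, w \notin K -> (#|[set v in K | adj w v]| <= 1)%N.

(** In EP_n six edges leaving the clique yield 6/N. Five leave a margin of 1/N, part of which pays
    for the correction terms of the test vector. *)
Lemma q_few_attachments w0 : w0 \notin K -> (forall v, v \in K -> ~~ adj w0 v) ->
  q R G < 2 * N%:R - 2 + 6 / N%:R.
Proof.
move=> w0K w0n.
have N0 : 0 < N%:R :> R by rewrite ltr0n; lia.
have N45' : 45 <= N%:R :> R by rewrite (ler_nat R 45).
(* At most five edges leave [K], and [5 * eta < 6 / N], while [N * eta > 1]
   leaves room for the weight 1/25 outside [K]. *)
pose eta : R := 59 / (50 * N%:R).
have etaN : N%:R * eta = 59 / 50.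
  by rewrite /eta; field; rewrite gt_eqF.
have eta0 : 0 < eta by rewrite divr_gt0 ?mulr_gt0.
have etale : eta <= 59 / 2250.
  by rewrite /eta ler_pdivrMr; [lra | rewrite mulr_gt0].
pose s u := #|[set v in ~: K | adj u v]|.
pose tau := (\sum_(u in K) s u)%N.
have tau5 : (tau <= 5)%N.
  have -> : tau = (\sum_(w in ~: K) #|[set v in K | adj w v]|)%N.
    rewrite /tau /s; under eq_bigr do rewrite -sum1dep_card.
    under [RHS]eq_bigr do rewrite -sum1dep_card.
    rewrite (exchange_big_dep (mem (~: K))) /=; last by move=> u v _ /andP[].
    apply: eq_bigr => w wK; apply: eq_bigl => u; rewrite wK adj_sym //.
  rewrite (bigD1 w0) ?inE //= [X in (X + _)%N](_ : _ = 0%N); last first.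
    by apply: eq_card0 => v; rewrite !inE; case vK: (v \in K); rewrite // (negPf (w0n v vK)).
  rewrite add0n (@leq_trans (\sum_(w in ~: K | w != w0) 1)) //.
    by apply: leq_sum => w /andP[]; rewrite inE => /one_nbr.
  have := cardCK; rewrite -sum1_card (bigD1 w0) ?inE //=.
  by move=> H; rewrite -ltnS -add1n H.
have le_s u : u \in K -> (s u <= tau)%N.
  by move=> uK; rewrite /tau (bigD1 u) //= leq_addr.
pose x u : R := if u \in K then 1 + (s u)%:R * eta else 1 / 25.
have x0 u : 0 < x u.
  rewrite /x; case: ifP => _; last by lra.
  by rewrite ltr_pwDl // mulr_ge0 // ltW.
have sumK u : \sum_(v | adj u v) x v = \sum_(v in K | adj u v) (1 + (s v)%:R * eta) +
    (s u)%:R / 25.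
  rewrite (bigID (mem K)) /=; congr (_ + _).
    rewrite [RHS]big_mkcondl big_mkcondr /=.
    by apply: eq_bigr => v _; rewrite /x; case: (v \in K).
  rewrite /s -sum1dep_card natr_sum mulr_suml.
  apply: eq_big => [v|v]; first by rewrite inE andbC.
  by move=> /andP[_ /negPf vK]; rewrite /x vK.
have degE u : degree u = (#|[set v in K | adj u v]| + s u)%N.
  rewrite /degree /s -(cardsID K); congr (_ + _)%N; apply: eq_card => v.
    by rewrite !inE andbC.
  by rewrite !inE.
apply: (@le_lt_trans _ _ (2 * N%:R - 2 + 5 * eta)); last first.
  rewrite ltrD2l ltr_pdivlMr //; nra.
apply: (q_le_test (x := x)) => // [|u]; first by apply/card_gt0P; exists w0.
rewrite /qop sumK degE.
case: (boolP (u \in K)) => uK.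
  have NK : #|[set v in K | adj u v]| = N.-1.
    rewrite -cardK (cardsD1 u K) uK /=; apply: eq_card => v; rewrite !inE.
    apply/andP/andP => [[vK uv]|[vu vK]]; split => //.
      by apply: contraTneq uv => ->; rewrite adj_irrefl.
    by apply: K_clique; rewrite // eq_sym.
  have -> : \sum_(v in K | adj u v) (1 + (s v)%:R * eta) =
      (N.-1)%:R + (tau - s u)%:R * eta.
    rewrite big_split /=; congr (_ + _).
      by rewrite -NK -sum1dep_card natr_sum.
    rewrite -mulr_suml; congr (_ * _); rewrite -natr_sum; congr (_%:R).
    rewrite /tau [X in (X - _)%N](bigD1 u) //= addKn; apply: eq_bigl => v.
    case: (boolP (v \in K)) => vK /=; last by []. case: (eqVneq v u) => [->|vu]; first by rewrite adj_irrefl.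
    by rewrite K_clique // eq_sym.
  have N1 : (0 < N)%N by lia.
  rewrite NK natrD natrB ?le_s // /x uK -subn1 natrB //.
  have : (s u)%:R <= tau%:R :> R by rewrite ler_nat le_s.
  have : tau%:R <= 5 :> R by rewrite (ler_nat R _ 5).
  have : 0 <= (s u)%:R :> R by [].
  move: ((s u)%:R : R) (tau%:R : R) => S T S0 T5 ST.
  (* After cancellation the coefficient of [S] is N eta - 1 - 1/25 = 7/50, reduced by S eta, which
     is at most 5 (59/2250) < 7/50. *)
  have e2 : 0 <= S * (7 / 50 - S * eta) by apply: mulr_ge0 => //; nra.
  have e3 : 0 <= S * eta ^+ 2 by rewrite mulr_ge0 ?exprn_ge0 // ltW.
  have e4 : 0 <= (5 - T) * eta by apply: mulr_ge0; lra.
  have e5 : N%:R * eta * S = 59 / 50 * S by rewrite etaN.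
  nra.
have su : (s u <= 5)%N.
  rewrite -ltnS -cardCK; apply: proper_card; apply/properP; split.
    by apply/subsetP => v; rewrite inE => /andP[].
  by exists u; rewrite ?inE // adj_irrefl andbF.
rewrite /x (negPf uK).
have ku := one_nbr uK.
have le1 : \sum_(v in K | adj u v) (1 + (s v)%:R * eta) <= 1 + 5 * eta.
  apply: (@le_trans _ _ (\sum_(v in K | adj u v) (1 + 5 * eta))).
    apply: ler_sum => v /andP[vK _]; rewrite lerD2l ler_wpM2r // ?(ltW eta0) //.
    by rewrite (ler_nat R _ 5) (leq_trans (le_s v vK)).
  rewrite sumr_const -[leRHS]mulr1n ler_wpMn2l //.
    by rewrite addr_ge0 // mulr_ge0 // ltW.
  apply: leq_trans ku; rewrite subset_leq_card //; apply/subsetP => v.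
  by rewrite !inE.
have : (#|[set v in K | adj u v]| + s u)%:R <= 6 :> R.
  by rewrite (ler_nat R _ 6) (leq_add ku su).
have : (s u)%:R <= 5 :> R by rewrite (ler_nat R _ 5).
move: ((s u)%:R : R) (_%:R : R) => a b; lra.
Qed.

End Bounds.

Lemma cardsE_sum (T : finType) (P : pred T) : #|[set v | P v]| = (\sum_v P v)%N.
Proof. by rewrite -sum1dep_card big_mkcond; apply: eq_bigr => v _; case: (P v). Qed.

Lemma sum_EP n (F : EP n -> nat) :
  (\sum_v F v = \sum_i F (EPq i) + (\sum_i F (EPb _ i) + \sum_i F (EPc _ i)))%N.
Proof.
rewrite (reindex (@EP_decode n)) /=; last first.
  by apply: onW_bij; exists (@EP_encode n); [apply: EP_decodeK|apply: EP_encodeK].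
by rewrite !big_sumType.
Qed.

(** The test set is the clique: its (n - 6)(n - 7) ordered pairs count twice, the six edges leaving
    it once, and the total is divided by n - 6. *)
Lemma q_EP_ge (R : realType) n : (9 <= n)%N ->
  2 * n%:R - 14 + 6 / (n%:R - 6) <= q R (EP n).
Proof.
move=> n9; pose S : {set EP n} := [set EPq i | i : 'I_(n - 6)].
have injq : injective (@EPq n) by move=> i j [].
have cS : #|S| = (n - 6)%N by rewrite card_imset // card_ord.
have S0 : S != set0 by rewrite -card_gt0 cS; lia.
have := @q_set_ge R (EP n) S S0; rewrite cS.
have -> : (\sum_(u in S) (degree u + #|[set v in S | adj u v]|) =
   2 * ((n - 6) * (n - 7)) + 6)%N.
  rewrite big_imset /=; last by move=> i j _ _; apply: injq.
  have memS (v : EP n) : (v \in S) = if v is EPq _ then true else false.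
    apply/imsetP/idP => [[i _ ->]//|]; case: v => // i _; by exists i.
  have sumq i : (\sum_(j < n - 6) (i != j) = n - 7)%N.
    transitivity #|predC1 i|; last by rewrite cardC1 card_ord; lia.
    rewrite -sum1_card [RHS]big_mkcond /=; apply: eq_bigr => j _.
    by rewrite inE eq_sym; case: eqP.
  have suma (k : 'I_3) : (\sum_(i < n - 6) (i == k :> nat) = 1)%N.
    have kn : (k < n - 6)%N by have := ltn_ord k; lia.
    rewrite (bigD1 (Ordinal kn)) //= eqxx big1 // => i.
    by rewrite -val_eqE /= => /negPf ->.
  (* The n - 7 neighbours in the clique count in the degree and again inside [S]; two more, b_k and
     c_k, occur exactly when the value of [i] is some k < 3. *)
  have degE (i : 'I_(n - 6)) : (degree (EPq i : EP n) +
      #|[set v in S | @adj (EP n) (EPq i) v]| = 2 * (n - 7) +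
      2 * \sum_(k < 3) (i == k :> nat))%N.
    rewrite /degree !cardsE_sum !sum_EP /=.
    rewrite [X in (_ + (X + _))%N](_ : _ = (n - 7)%N); last first.
      by rewrite -(sumq i); apply: eq_bigr => j _; rewrite memS.
    rewrite [X in (_ + (_ + X))%N](_ : _ = 0%N); last first.
      by rewrite !big1 // => j _; rewrite memS.
    by rewrite sumq; lia.
  under eq_bigr do rewrite degE.
  rewrite big_split /= sum_nat_const card_ord -big_distrr /= exchange_big /=.
  by under eq_bigr do rewrite suma; rewrite sum_nat_const card_ord; lia.
have -> : (2 * ((n - 6) * (n - 7)) + 6)%:R =
    (n - 6)%:R * (2 * n%:R - 14) + 6 :> R.
  by rewrite natrD !natrM !natrB; [ring|lia|lia].
have n6 : 0 < (n - 6)%:R :> R by rewrite ltr0n; lia.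
have -> : n%:R - 6 = (n - 6)%:R :> R by rewrite natrB //; lia.
rewrite -ler_pdivrMr // => le; apply: le_trans le.
rewrite le_eqVlt; apply/orP; left; apply/eqP; field.
by rewrite gt_eqF.
Qed.

End Spectral.

(** * The extremal graph *)

Section Embedding.
Variables (T : finType) (e : rel T).
Hypotheses (sym_e : symmetric e) (irr_e : irreflexive e).
Hypotheses (claw_e : claw_free_rel e) (diamond_e : diamond_free_rel e).
Variable K : {set T}.
Hypotheses (cK : clique e K) (K_ge3 : 3 <= #|K|).
Hypothesis one_nbr : forall w, w \notin K -> #|[set u in K | e w u]| <= 1.
Hypothesis not_ham : ~ hamiltonian_rel e.

(** Rotating and swapping the net transfers the nonadjacencies to all ordered pairs of distinct
    corners, so no edge of [e] falls outside EP_n. *)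
Lemma net_embedding a1 b1 c1 a2 b2 c2 a3 b3 c3 :
  net e K a1 b1 c1 a2 b2 c2 a3 b3 c3 ->
  exists2 f : EP #|T| -> T, bijective f & forall u v, e (f u) (f v) -> adj u v.
Proof.
move=> N.
have nn := net_nonadjacent sym_e cK K_ge3 not_ham.
have nK := net_K_nbr sym_e claw_e diamond_e cK K_ge3 one_nbr not_ham.
have N2 := net_rot sym_e N; have N3 := net_rot sym_e N2.
have [n12 m12] := nn _ _ _ _ _ _ _ _ _ N.
have [n23 m23] := nn _ _ _ _ _ _ _ _ _ N2.
have [n31 m31] := nn _ _ _ _ _ _ _ _ _ N3.
have [n21 m21] := nn _ _ _ _ _ _ _ _ _ (net_swap sym_e N).
have [n32 m32] := nn _ _ _ _ _ _ _ _ _ (net_swap sym_e N2).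
have [n13 m13] := nn _ _ _ _ _ _ _ _ _ (net_swap sym_e N3).
have k1 k := nK _ _ _ _ _ _ _ _ _ k N.
have k2 k := nK _ _ _ _ _ _ _ _ _ k N2.
have k3 k := nK _ _ _ _ _ _ _ _ _ k N3.
case: N {N2 N3} => -[uW Wb] [ua aK] [ac1 ac2 ac3] [cb1 cb2 cb3] [b12 b13 b23].
have WK x : x \in [:: b1; c1; b2; c2; b3; c3] -> x \notin K by rewrite -Wb inE.
pose a (i : 'I_3) := nth a1 [:: a1; a2; a3] i.
pose b (i : 'I_3) := nth a1 [:: b1; b2; b3] i.
pose c (i : 'I_3) := nth a1 [:: c1; c2; c3] i.
have aiK i : a i \in K by apply: (allP aK); rewrite mem_nth.
have bK i : b i \notin K.
  by apply: WK; case: i => [[|[|[|//]]] ilt]; rewrite !inE eqxx ?orbT.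
have ciK i : c i \notin K.
  by apply: WK; case: i => [[|[|[|//]]] ilt]; rewrite !inE eqxx ?orbT.
have ac i : e (a i) (c i) by case: i => [[|[|[|//]]] ilt].
have bnbr i k : k \in K -> e (b i) k -> k = a i.
  by case: i => [[|[|[|//]]] ilt]; [apply: k1|apply: k2|apply: k3].
have cnbr i k : k \in K -> e (c i) k -> k = a i.
  by move=> kK ck; apply: (K_nbr_uniq one_nbr (ciK i)); rewrite // sym_e.
have cb i j : e (c i) (b j) -> i = j.
  move=> h; apply/val_inj; move: h.
  by case: i j => [[|[|[|//]]] ilt] [[|[|[|//]]] jlt] //= h;
    rewrite /c /b /= ?(negPf n12) ?(negPf n13) ?(negPf n21) ?(negPf n23) ?(negPf n31) ?(negPf n32) in h.
have cc i j : e (c i) (c j) = false.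
  by case: i j => [[|[|[|//]]] ilt] [[|[|[|//]]] jlt]; rewrite /c /= ?irr_e //; apply: negPf.
have uW' : uniq ([:: b1; b2; b3] ++ [:: c1; c2; c3]).
  have p : perm_eq ([:: b1; b2; b3] ++ [:: c1; c2; c3]) [:: b1; c1; b2; c2; b3; c3].
    by apply/permP => x /=; goal_lia.
  by rewrite (perm_uniq p).
move: uW'; rewrite cat_uniq => /and3P[ub /hasPn bc uc].
have injb : injective b.
  by move=> i j /eqP; rewrite nth_uniq // => /eqP /val_inj.
have injc : injective c.
  by move=> i j /eqP; rewrite nth_uniq // => /eqP /val_inj.
have nbc i j : b i != c j.
  have : c j \notin [:: b1; b2; b3] by apply: bc; rewrite mem_nth.
  by apply: contraNneq => <-; rewrite mem_nth.
(* The three attached vertices come first, since in [EP] the vertex a_i is the clique vertex with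
   value i. *)
pose s := [:: a1; a2; a3] ++ [seq k <- enum K | k \notin [:: a1; a2; a3]].
have us : uniq s.
  rewrite cat_uniq ua filter_uniq ?enum_uniq // andbT.
  by apply/hasPn => x; rewrite mem_filter => /andP[].
have sK x : (x \in s) = (x \in K).
  rewrite mem_cat mem_filter mem_enum; case: (boolP (x \in [:: _; _; _])) => //= xa.
  by rewrite (allP aK).
have cardK : size s = #|K| by rewrite -(card_uniqP us); apply: eq_card => x; rewrite sK.
have cardW : #|~: K| = 6.
  by rewrite (eq_card Wb) (card_uniqP uW).
have nK6 : #|T| - 6 = size s by rewrite cardK -(cardsC K) cardW addnK.
pose f (u : EP #|T|) : T := match u with
  | EPq i => nth a1 s i | EPb i => b i | EPc i => c i end.
have si (i : 'I_(#|T| - 6)) : i < size s by rewrite -nK6.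
have fqK i : f (EPq i) \in K by rewrite -sK mem_nth.
have fqa i j : f (EPq i) = a j -> i == j :> nat.
  have -> : a j = nth a1 s j by rewrite nth_cat /= ltn_ord.
  move=> /eqP; rewrite nth_uniq // cardK; exact: leq_trans (ltn_ord j) K_ge3.
have injf : injective f.
  move=> [i|i|i] [j|j|j] /= h.
  - by congr EPq; apply/val_inj/eqP; rewrite -(nth_uniq a1 (si i) (si j) us) h.
  - by move: (fqK i); rewrite /= h (negPf (bK j)).
  - by move: (fqK i); rewrite /= h (negPf (ciK j)).
  - by move: (fqK j); rewrite /= -h (negPf (bK i)).
  - by rewrite (injb _ _ h).
  - by move: (nbc i j); rewrite h eqxx.
  - by move: (fqK j); rewrite /= -h (negPf (ciK i)).
  - by move: (nbc j i); rewrite -h eqxx.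
  - by rewrite (injc _ _ h).
exists f.
  apply: inj_card_bij injf _; rewrite card_EP // -(cardsC K) cardW.
  by rewrite (leq_add2r 6 3).
move=> [i|i|i] [j|j|j] /= h.
- by apply: contraTneq h => ->; rewrite irr_e.
- by apply: fqa; apply: bnbr (fqK i) _; rewrite sym_e.
- by apply: fqa; apply: cnbr (fqK i) _; rewrite sym_e.
- by apply: fqa; apply: bnbr (fqK j) _.
- by apply: contraTneq h => ->; rewrite irr_e.
- by apply/eqP/esym/cb; rewrite sym_e.
- by apply: fqa; apply: cnbr (fqK j) _.
- exact/eqP/esym/cb.
- by rewrite cc in h.
Qed.
End Embedding.

(** * From 2-connected claw-free graphs to diamond-free ones *)

Lemma connect_crossing (T : finType) (r : rel T) (A : pred T) x y :
  connect r x y -> A x -> ~~ A y -> exists s t, [/\ A s, ~~ A t & r s t].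
Proof.
case/connectP => p; elim: p x => [|z p IH] x /=; first by move=> _ -> ->.
move=> /andP[xz pz] yE Ax nAy; case: (boolP (A z)) => Az; last by exists x, z.
exact: (IH z).
Qed.

Lemma k_connected_two (G : sgraph) : k_connected 2 G -> two_connected_rel (@adj G).
Proof.
case=> _ conn v S /set0Pn[x xS] vS /set0Pn[y].
rewrite !inE => /norP[yv yS].
have xv : x \in ~: [set v].
  by rewrite !inE; apply: contraNneq vS => <-.
have yv' : y \in ~: [set v] by rewrite !inE.
have Sv : #|[set v]| < 2 by rewrite cards1.
have := conn [set v] Sv (exist _ x xv) (exist _ y yv').
move/(@connect_crossing _ _ (fun w => val w \in S)) => /(_ xS yS).
case=> s [t [sS tS st]]; exists (val s), (val t); split=> //.
by have := valP t; rewrite !inE.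
Qed.

(** If [v] is the only vertex outside [S], the hypothesis says nothing about [S] and [v]; it is then
    applied to the set {v} with a vertex of [S] removed. *)
Lemma two_connected_cut (T : finType) (e : rel T) : symmetric e -> 2 < #|T| ->
  two_connected_rel e -> edge_cut_nonempty e.
Proof.
move=> sym_e T3 conn S S0 /set0Pn[v]; rewrite inE => vS.
have [Sv|] := eqVneq (~: (v |: S)) set0; last first.
  by move=> /(conn v S S0 vS)[x [y [xS yS _ xy]]]; exists x, y.
have /set0Pn[v0 v0S] := S0.
have v0v : v0 \notin [set v] by rewrite inE; apply: contraNneq vS => <-.
have [||x [y [xv yv _ xy]]] := conn v0 [set v] _ v0v.
- by apply/set0Pn; exists v; rewrite inE.
- rewrite -card_gt0 cardsCs setCK cardsU1 v0v cards1; lia.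
move: xv yv xy; rewrite !inE => /eqP -> yv vy; exists y, v; split=> //; last by rewrite sym_e.
have /setP/(_ y) := Sv; rewrite !inE (negPf yv) /=.
by move/negbFE.
Qed.

Lemma claw_free_pairwise (G : sgraph) : claw_free G -> claw_free_rel (@adj G).
Proof.
move=> cf c u v w cu cv cw uv uw vw; apply: contraT => /norP[nuv /norP[nuw nvw]].
pose l := [:: c; u; v; w]; pose S := [set x in l]; exfalso; apply: (cf S).
have neq x : adj c x -> c != x by apply: contraTneq => <-; rewrite adj_irrefl.
have ul : uniq l by rewrite /= !inE !negb_or !neq // uv uw vw.
(* Positions in [l] translate into vertices of the claw: position 0 is the centre and position k + 1
   the leaf k. *)
pose g i : Kmn 1 3 := if i is k.+1 then inr (inord k) else inl ord0.
pose f (x : induced S) : Kmn 1 3 := g (index (val x) l).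
have fE x : exists i, [/\ i < 4, val x = nth c l i & f x = g i].
  have xl : val x \in l by have := valP x; rewrite inE.
  by exists (index (val x) l); split; rewrite // ?index_mem ?nth_index.
have injf : injective f.
  move=> x y; have [i [i4 xi ->]] := fE x; have [j [j4 yj ->]] := fE y => gij.
  apply: val_inj; rewrite xi yj; congr nth.
  case: i j i4 j4 gij {xi yj} => [|i] [|j] // i4 j4 [ij].
  by move/(congr1 val): ij; rewrite /= !inordK // => ->.
exists f.
  apply: inj_card_bij injf _; rewrite card_sum !card_ord card_sig.
  apply: (@leq_trans (size l)) => //; rewrite -(card_uniqP ul).
  by apply: subset_leq_card; apply/subsetP => x; rewrite !inE.
move=> x y; rewrite [RHS]/= /induced_adj.
have [i [i4 -> ->]] := fE x; have [j [j4 -> ->]] := fE y.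
by case: i j i4 j4 => [|[|[|[|//]]]] [|[|[|[|//]]]] _ _ /=; rewrite ?adj_irrefl ?cu ?cv ?cw //;
  rewrite 1?adj_sym ?cu ?cv ?cw ?(negPf nuv) ?(negPf nuw) ?(negPf nvw) // adj_sym
    ?(negPf nuv) ?(negPf nuw) ?(negPf nvw).
Qed.

Section Main.
Variables (R : realType) (n : nat).
Hypothesis n51 : 51 <= n.

Lemma closed_case (G : sgraph) : #|G| = n -> two_connected_rel (@adj G) ->
  claw_free_rel (@adj G) -> diamond_free_rel (@adj G) ->
  (q R (EP n) <= q R G)%R -> isomorphic G (EP n) \/ hamiltonian_rel (@adj G).
Proof.
move=> cardG conn claw diam qG.
have G0 : 0 < #|G| by rewrite cardG; lia.
have G3 : 2 < #|G| by rewrite cardG; lia.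
have cut := two_connected_cut (@adj_sym G) G3 conn.
have qEP : (2 * n%:R - 14 + 6 / (n%:R - 6) <= q R (EP n))%R by apply: q_EP_ge; lia.
have n6 : (0 < n%:R - 6 :> R)%R by rewrite subr_gt0 (ltr_nat R 6); lia.
have deg0 (v : G) : 0 < degree v.
  have [||x [y [xv yv xy]]] := cut [set v].
  - by apply/set0Pn; exists v; rewrite inE.
  - by rewrite -card_gt0 cardsCs setCK cards1; lia.
  by apply/card_gt0P; exists y; move: xv xy; rewrite !inE => /eqP ->.
have [v Hv] : exists v : G,
    (2 * #|G| - 14) * degree v < degree v ^ 2 + \sum_(u | adj v u) degree u.
  apply: contrapT => /forallNP nv.
  have : (q R G <= (2 * n - 14)%:R)%R.
    apply: q_le_degree => // t; rewrite -natrM ler_nat -cardG leqNgt.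
    exact/negP/nv.
  rewrite natrB ?natrM; last by lia.
  have : (0 < 6 / (n%:R - 6) :> R)%R by rewrite divr_gt0.
  move: qEP qG; lra.
have [K [cK W6 one]] := large_clique (@adj_sym G) (@adj_irrefl G) claw diam
  (eq_ind_r (fun m => 51 <= m) n51 cardG) Hv.
have K45 : 45 <= #|K| by have := cardsC K; rewrite cardG; lia.
have K3 : 3 <= #|K| by apply: leq_trans K45.
have attached : #|~: K| = 6 -> forall w, w \notin K -> exists2 k, k \in K & adj w k.
  move=> W6' w wK; apply: contrapT => nk.
  have cardK : #|K| = n - 6 by have := cardsC K; rewrite cardG W6'; lia.
  have N45 : 45 <= n - 6 by lia.
  have := @q_few_attachments R G K (n - 6) cK cardK W6' N45 one w wK.
  have nk' : forall v, v \in K -> ~~ adj w v.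
    by move=> t tK; apply/negP => wt; apply: nk; exists t.
  move/(_ nk'); rewrite natrB; last by lia.
  move: qEP qG; lra.
have [ham|nham] := pselect (hamiltonian_rel (@adj G)); first by right.
have [//|[a1 [b1 [c1 [a2 [b2 [c2 [a3 [b3 [c3 N]]]]]]]]]] :=
  hamiltonian_or_net (@adj_sym G) claw conn cK K3 one W6 attached.
(* The embedding goes from [EP n] to [G]; its inverse exhibits [G] as a spanning subgraph of
   [EP n]. *)
left; have := net_embedding (@adj_sym G) (@adj_irrefl G) claw diam cK K3 one nham N.
rewrite cardG => -[f [g fK gK] fadj].
apply: (@q_spanning_eq R G (EP n) g) => //; first by exists f.
by move=> s t st; apply: fadj; rewrite !gK.
Qed.

(** Induction on the number of nonadjacent ordered pairs: completing at a centre of an induced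
    diamond adds at least the edge missing from the diamond. *)
Lemma hamiltonian_or_EP (G : sgraph) : #|G| = n -> two_connected_rel (@adj G) ->
  claw_free_rel (@adj G) -> (q R (EP n) <= q R G)%R ->
  isomorphic G (EP n) \/ hamiltonian_rel (@adj G).
Proof.
have [m] := ubnP #|[set p : G * G | ~~ adj p.1 p.2]|.
elim: m G => // m IH G /ltnSE Gm cardG conn claw qG.
have G0 : 0 < #|G| by rewrite cardG; lia.
have G3 : 2 < #|G| by rewrite cardG; lia.
have [diam|] := pselect (diamond_free_rel (@adj G)); first exact: closed_case.
move=> /existsNP[x] /existsNP[y] /existsNP[z] /existsNP[u].
move=> /not_implyP[xy] /not_implyP[xz] /not_implyP[xu] /not_implyP[yz].
move=> /not_implyP[zu] /not_implyP[yu] /negP nyu.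
pose G' := SGraph (local_completion_sym (@adj_sym G) x)
                  (local_completion_irrefl (@adj_irrefl G) x).
have sub s t : @adj G s t -> @adj G' s t by rewrite /= /local_completion => ->.
have qG' : (q R G <= q R G')%R.
  by apply: (@q_spanning_le R G G' id) => //; exists id.
have lt_m : #|[set p : G' * G' | ~~ adj p.1 p.2]| < m.
  apply: leq_trans Gm; apply: proper_card; apply/properP; split.
    by apply/subsetP => p; rewrite !inE; apply: contra => /sub.
  exists (y, u); rewrite !inE ?nyu //= negbK /local_completion yu.
  by rewrite (xy : adj x y) (xu : adj x u) orbT.
have conn' : two_connected_rel (@adj G').
  move=> v S S0 vS vS0; have [s [t [sS tS tv st]]] := conn v S S0 vS vS0.
  by exists s, t; split=> //; apply: sub.
have claw' := local_completion_claw_free (@adj_sym G) claw (x := x).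
have [[f bijf fadj]|ham] := IH G' lt_m cardG conn' claw' (le_trans qG qG').
  (* The same bijection embeds [G] into [EP n] as a spanning subgraph, and q leaves room for no
     further edge. *)
  left; apply: (@q_spanning_eq R G (EP n) f) => //.
    by move=> s t st; rewrite fadj; apply: sub.
  exact: two_connected_cut (@adj_sym G) G3 conn.
right; apply: (local_completion_hamiltonian (@adj_sym G) (@adj_irrefl G) claw _ ham).
have cross (A : pred G) s t : adj x s -> adj x t -> adj s t -> A s != A t ->
    exists p q, [/\ adj x p, adj x q, A p, ~~ A q & adj p q].
  move=> xs xt st; case: (boolP (A s)) => As; case: (boolP (A t)) => At // _.
    by exists s, t.
  by exists t, s; split=> //; rewrite adj_sym.
move=> A p p' xp Ap xp' nAp'.
have [Ayz|/(cross A y z xy xz yz) //] := eqVneq (A y) (A z).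
have [Azu|/(cross A z u xz xu zu) //] := eqVneq (A z) (A u).
(* As [y] and [u] are nonadjacent, every other neighbour [t] of [x] is adjacent to one of them, so
   N(x) hangs together along the path y, z, u. *)
have side t : adj x t -> A t != A y ->
    exists p q, [/\ adj x p, adj x q, A p, ~~ A q & adj p q].
  move=> xt Aty.
  have ty : y != t by apply: contraNneq Aty => ->; rewrite eqxx.
  have tu : u != t by apply: contraNneq Aty => <-; rewrite Ayz Azu eqxx.
  have := claw x y u t xy xu xt yu ty tu; rewrite (negPf nyu) /= => /orP[yt|ut].
    by apply: (cross A y t xy xt yt); rewrite eq_sym.
  by apply: (cross A u t xu xt ut); rewrite -Azu -Ayz eq_sym.
case Ay: (A y); first by apply: (side p' xp'); rewrite Ay (negPf nAp').
by apply: (side p xp); rewrite Ay Ap.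
Qed.
End Main.

Theorem theorem9 (R : realType) (n : nat) (G : sgraph) :
  (51 <= n)%N -> #|G| = n -> k_connected 2 G -> claw_free G ->
  (q R (EP n) <= q R G)%R ->
  ~ isomorphic G (EP n) -> hamiltonian G.
Proof.
move=> n51 cardG conn claw qG nEP.
have [//|ham] := hamiltonian_or_EP n51 cardG (k_connected_two conn)
  (claw_free_pairwise claw) qG.
exact: ham.
Qed.
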